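(* A connected graph $\Gamma$ is a locally-finite connected-homogeneous bipartite graph if and only if $\Gamma$ is isomorphic to one of the following: a cycle $C_m$ with $m$ even; an infinite semiregular tree $T_{a,b}$ ($a,b\in\mathbb{N}$); a complete bipartite graph $K_{m,n}$ ($m,n\in\mathbb{N}$); the complement of a perfect matching.
   Context: Let $\Gamma$ be a bipartite graph with a given bipartition $X\cup Y$. An automorphism of the bipartite graph is a graph automorphism $\varphi$ with $\varphi(X)=X$, $\varphi(Y)=Y$. $\Gamma$ is a connected-homogeneous bipartite graph if every isomorphism between finite connected induced subgraphs that maps vertices of $X$ to vertices of $X$ and vertices of $Y$ to vertices of $Y$ extends to an automorphism of the bipartite graph $\Gamma$. Locally-finite means every vertex has finite degree. $T_{a,b}$ denotes the infinite tree in which every vertex of one part of the bipartition has degree $a$ and every vertex of the other has degree $b$. The complement of a perfect matching on $2n$ vertices is the bipartite graph with parts $X,Y$ of size $n$, a bijection $\eta:X\to Y$, and $x\sim y$ iff $y\neq\eta(x)$. *)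

(* Defs.v *)
From Stdlib Require Import Relations List.
From mathcomp Require Import all_boot.
Import ListNotations.


Set Implicit Arguments.
Unset Strict Implicit.
Unset Printing Implicit Defensive.

Definition simple_graph (V : Type) (adj : V -> V -> Prop) : Prop :=
  (forall x y, adj x y -> adj y x) /\ (forall x, ~ adj x x).

Definition conn_in (V : Type) (adj : V -> V -> Prop) (A : V -> Prop) : V -> V -> Prop :=
  clos_refl_trans V (fun u v => A u /\ A v /\ adj u v).

Definition connected_set (V : Type) (adj : V -> V -> Prop) (A : V -> Prop) : Prop :=
  forall x y, A x -> A y -> conn_in adj A x y.

Definition connected_graph (V : Type) (adj : V -> V -> Prop) : Prop :=
  inhabited V /\ connected_set adj (fun _ => True).

Definition finite_set (V : Type) (A : V -> Prop) : Prop :=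
  exists l : list V, forall x, A x -> List.In x l.

Definition locally_finite (V : Type) (adj : V -> V -> Prop) : Prop :=
  forall v, finite_set (adj v).

Definition has_degree (V : Type) (adj : V -> V -> Prop) (v : V) (d : nat) : Prop :=
  exists l : list V, List.NoDup l /\ length l = d /\ (forall w, adj v w <-> List.In w l).

(* part x = true means x ∈ X, false means x ∈ Y; every edge joins X and Y. *)
Definition bipartition (V : Type) (adj : V -> V -> Prop) (part : V -> bool) : Prop :=
  forall x y, adj x y -> part x <> part y.

Definition bip_automorphism (V : Type) (adj : V -> V -> Prop) (part : V -> bool)
    (phi : V -> V) : Prop :=
  (exists psi : V -> V, (forall x, psi (phi x) = x) /\ (forall y, phi (psi y) = y)) /\
  (forall x y, adj x y <-> adj (phi x) (phi y)) /\
  (forall x, part (phi x) = part x).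

Definition bip_induced_iso (V : Type) (adj : V -> V -> Prop) (part : V -> bool)
    (A B : V -> Prop) (f : V -> V) : Prop :=
  (forall x, A x -> B (f x)) /\
  (forall x y, A x -> A y -> f x = f y -> x = y) /\
  (forall y, B y -> exists x, A x /\ f x = y) /\
  (forall x y, A x -> A y -> (adj x y <-> adj (f x) (f y))) /\
  (forall x, A x -> part (f x) = part x).

Definition connected_homogeneous_bip (V : Type) (adj : V -> V -> Prop)
    (part : V -> bool) : Prop :=
  forall (A B : V -> Prop) (f : V -> V),
    finite_set A -> finite_set B ->
    connected_set adj A -> connected_set adj B ->
    bip_induced_iso adj part A B f ->
    exists phi, bip_automorphism adj part phi /\ (forall x, A x -> phi x = f x).

Definition graph_iso (V W : Type) (adjV : V -> V -> Prop) (adjW : W -> W -> Prop) : Prop :=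
  exists (f : V -> W) (g : W -> V),
    (forall x, g (f x) = x) /\ (forall y, f (g y) = y) /\
    (forall x y, adjV x y <-> adjW (f x) (f y)).

Definition has_cycle (V : Type) (adj : V -> V -> Prop) : Prop :=
  exists (k : nat) (c : nat -> V),
    3 <= k /\ (forall i j, i < k -> j < k -> c i = c j -> i = j) /\
    (forall i, i < k -> adj (c i) (c ((i + 1) %% k))).

Definition is_tree (V : Type) (adj : V -> V -> Prop) : Prop :=
  connected_graph adj /\ ~ has_cycle adj.

Definition infinite_type (V : Type) : Prop := ~ finite_set (fun _ : V => True).

Definition is_semiregular_tree (V : Type) (adj : V -> V -> Prop) (a b : nat) : Prop :=
  is_tree adj /\ infinite_type V /\
  exists part : V -> bool, bipartition adj part /\
    (forall v, part v -> has_degree adj v a) /\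
    (forall v, ~~ part v -> has_degree adj v b).

Definition cycle_adj (m : nat) (i j : 'I_m) : Prop :=
  (val j = (val i + 1) %% m) \/ (val i = (val j + 1) %% m).

Definition Kmn_adj (m n : nat) (x y : 'I_m + 'I_n) : Prop :=
  match x, y with
  | inl _, inr _ => True
  | inr _, inl _ => True
  | _, _ => False
  end.

(* Complement of a perfect matching on 2n vertices: X = Y = 'I_n (as inl/inr),
   eta = identity, x ~ y iff y <> eta x. *)
Definition cpm_adj (n : nat) (x y : 'I_n + 'I_n) : Prop :=
  match x, y with
  | inl i, inr j => i <> j
  | inr j, inl i => i <> j
  | _, _ => False
  end.

(* Main.v *)
Require Import Defs.
From Stdlib Require Import Relations.
From mathcomp Require Import all_boot fingroup perm ssralg zmodp.
From mathcomp Require Import boolp zify ring.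

(** Let the graph be homogeneous, with some path of length 3 whose ends are not adjacent
    (otherwise it is complete bipartite); then every degree is at least 2. Without cycles it
    is an infinite semiregular tree, and with all degrees 2 it is a tree or a cycle.

    Suppose some degree is at least 3 and there is a cycle. If there is no 4-cycle, moving
    one vertex of a shortest cycle produces a 6-cycle, so the girth is 6, every path of
    length 4 closes up, and the graph is the incidence graph of a projective plane; but
    homogeneity cannot distinguish three concurrent lines through three collinear points
    from three non-concurrent ones. If there is a 4-cycle, let x ~ y have degrees a and b.
    The k common neighbours of x and a vertex at distance 2 form an arbitrary k-subset of
    N(x), so 'C(a - 1, k - 1) <= b - 1, and symmetrically; hence a = b, k is 2 or a - 1, and
    a vertex of N(y) is determined by its neighbours in N(x). The case k = 2 < a - 1 is
    contradictory, and k = a - 1 in both parts is the complement of a perfect matching.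

    Conversely, partial isomorphisms of the finite graphs extend to permutations of the
    parts or to dihedral maps, and those of a semiregular tree to a covering map of the
    tree by itself, which is an automorphism. *)
Set Implicit Arguments.
Unset Strict Implicit.
Unset Printing Implicit Defensive.

(** * Enumerations of finite sets *)

Definition enumerates (V : Type) (P : V -> Prop) (n : nat) (e : 'I_n -> V) : Prop :=
  injective e /\ forall w, P w <-> exists i, e i = w.

Lemma InP (T : eqType) (x : T) (s : seq T) : reflect (List.In x s) (x \in s).
Proof.
elim: s => [|y s IHs] /=; first by constructor.
rewrite inE; apply: (iffP orP) => [[/eqP ->|/IHs]|[->|/IHs]]; by [left|right|left; rewrite eqxx].
Qed.

Lemma NoDup_uniq (T : eqType) (s : seq T) : List.NoDup s <-> uniq s.
Proof.
elim: s => [|x s IHs] /=; first by split=> // _; constructor.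
split=> [H|/andP[xNs us]].
  inversion H; subst; apply/andP; split; last by apply/IHs.
  by apply/negP => /InP.
by constructor; [move/InP; apply/negP | apply/IHs].
Qed.

Lemma uniq_enumerates (V : Type) (P : V -> Prop) (s : seq {classic V}) :
  uniq s -> (forall x, P x <-> x \in s) -> exists e : 'I_(size s) -> V, enumerates P e.
Proof.
move=> us Ps; exists (tnth (in_tuple s)); split.
  move=> i j; have x0 := tnth (in_tuple s) i; rewrite !(tnth_nth x0) /= => eij.
  by apply/val_inj/eqP; rewrite /= -(nth_uniq x0 (ltn_ord i) (ltn_ord j) us) eij.
by move=> w; rewrite Ps; split => [/(tnthP (in_tuple s))[i ->]|[i <-]];
  [exists i | rewrite (mem_tnth i (in_tuple s))].
Qed.

Lemma finite_enumerates (V : Type) (P : V -> Prop) :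
  finite_set P -> exists n (e : 'I_n -> V), enumerates P e.
Proof.
case=> l Pl; pose s : seq {classic V} := undup (@filter {classic V} (fun x => `[<P x>]) l).
exists (size s); apply: uniq_enumerates => [|x]; first exact: undup_uniq.
have -> : (x \in s) = `[<P x>] && (x \in (l : seq {classic V})).
  by rewrite (@mem_undup {classic V}) (@mem_filter {classic V}).
split=> [Px|/andP[/asboolP //]].
by apply/andP; split; [apply/asboolP | apply/InP/Pl].
Qed.

Lemma has_degreeP (V : Type) (adj : V -> V -> Prop) (v : V) (d : nat) :
  has_degree adj v d <-> exists e : 'I_d -> V, enumerates (adj v) e.
Proof.
split=> [[l [/(@NoDup_uniq {classic V}) ul [<- Pl]]]|[e [inj_e eP]]].
  by apply: (@uniq_enumerates _ _ l) => // x; rewrite Pl; split=> /(@InP {classic V}).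
exists [seq e i | i <- enum 'I_d]; split; last split.
- by apply/(@NoDup_uniq {classic V}); rewrite (@map_inj_uniq _ {classic V}) ?enum_uniq.
- by rewrite -[LHS]/(size _) size_map size_enum_ord.
- move=> w; rewrite eP; split=> [[i <-]|/(@InP {classic V})/mapP[i _ ->]]; last by exists i.
  by apply/(@InP {classic V})/map_f; rewrite mem_enum.
Qed.

Lemma enumerates_finite (V : Type) (P : V -> Prop) n (e : 'I_n -> V) :
  enumerates P e -> finite_set P.
Proof.
case=> _ eP; exists [seq e i | i <- enum 'I_n] => w /eP[i <-].
by apply/(@InP {classic V})/map_f; rewrite mem_enum.
Qed.

(** * Extending partial injections to permutations *)

Lemma perm_of_seqs (T : finType) (s t : seq T) :
  uniq s -> uniq t -> size s = size t -> exists p : {perm T}, map p s = t.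
Proof.
(* Both sequences are completed to duplicate-free lists of all of [T]; the permutation matches
   positions. *)
have ext (r : seq T) : uniq r -> exists q : seq T, uniq (r ++ q) /\ size (r ++ q) = #|T|.
  move=> ur; exists (enum [predC r]); split.
    by rewrite cat_uniq ur enum_uniq /= andbT; apply/hasPn => x; rewrite mem_enum inE.
  by rewrite size_cat -cardE -(card_uniqP ur) cardC.
move=> us ut st; have [s' [us' ss']] := ext s us; have [t' [ut' st']] := ext t ut.
have mem_s x : x \in s ++ s'.
  have : [set y in s ++ s'] == setT.
    by rewrite eqEcard subsetT cardsT cardsE (card_uniqP us') ss' /=.
  by move/eqP/setP/(_ x); rewrite !inE.
have idx x : index x (s ++ s') < size (t ++ t') by rewrite st' -ss' index_mem.
have f_inj : injective (fun x => nth x (t ++ t') (index x (s ++ s'))).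
  move=> x y; rewrite (set_nth_default x y) // => /eqP.
  by rewrite nth_uniq // => /eqP /(congr1 (nth x (s ++ s'))); rewrite !nth_index.
exists (perm f_inj); case: s => [|x0 s] in us st us' ss' mem_s idx f_inj *.
  exact/esym/size0nil/esym.
apply: (@eq_from_nth _ x0) => [|i]; rewrite size_map // => ilt.
rewrite (nth_map x0) // permE.
have -> : nth x0 (x0 :: s) i = nth x0 ((x0 :: s) ++ s') i by rewrite nth_cat ilt.
rewrite index_uniq //; last by rewrite size_cat (leq_trans ilt) ?leq_addr.
by rewrite nth_cat -st ilt; apply: set_nth_default; rewrite -st.
Qed.

Lemma extend_perm (T : finType) (A : {pred T}) (h : T -> T) :
  {in A &, injective h} -> exists p : {perm T}, {in A, p =1 h}.
Proof.
move=> inj_h; have [||p] := @perm_of_seqs T (enum A) (map h (enum A)) (enum_uniq A).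
- by rewrite map_inj_in_uniq ?enum_uniq // => x y; rewrite !mem_enum; apply: inj_h.
- by rewrite size_map.
by move=> /eq_in_map Ep; exists p => x xA; apply: Ep; rewrite mem_enum.
Qed.

Lemma perm_set_fixing (T : finType) (x0 : T) (A B : {set T}) :
  x0 \in A -> x0 \in B -> #|A| = #|B| ->
  exists p : {perm T}, p x0 = x0 /\ p @: A = B.
Proof.
move=> x0A x0B AB.
have [|||p] := @perm_of_seqs T (x0 :: enum (A :\ x0)) (x0 :: enum (B :\ x0)).
- by rewrite /= enum_uniq mem_enum !inE eqxx.
- by rewrite /= enum_uniq mem_enum !inE eqxx.
- by move: AB; rewrite /= -!cardE (cardsD1 x0 A) (cardsD1 x0 B) x0A x0B !add1n => -[->].
case=> px0 Ep; exists p; split=> //.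
rewrite -(setD1K x0A) -(setD1K x0B) imsetU1 px0; congr (_ |: _).
apply/setP => y; rewrite -[RHS]mem_enum -Ep.
apply/imsetP/mapP => -[x xA ->]; exists x => //; by [rewrite mem_enum | rewrite mem_enum in xA].
Qed.

(** * Lower bounds for binomial coefficients *)

Lemma leq_bin n m : 0 < m < n -> n <= 'C(n, m).
Proof.
elim: n m => [|n IHn] m mn //; case: m mn => // m mn; rewrite binS.
have [->|m0] := posnP m; first by rewrite bin1 bin0 addn1.
have := IHn m; have : 0 < 'C(n, m.+1) by rewrite bin_gt0; lia.
lia.
Qed.

(** Pascal's rule gives two terms, each at least [n - 1] by [leq_bin], and the hypothesis forces
    [n >= 4]. *)
Lemma ltn_bin n m : 1 < m < n.-1 -> n < 'C(n, m).
Proof.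
case: n => [|n]; first by lia.
case: m => // m mn; rewrite binS.
have := @leq_bin n m; have := @leq_bin n m.+1; lia.
Qed.

(** * Homogeneity *)

Section ConnectedSets.

Variables (V : Type) (adj : V -> V -> Prop).
Hypothesis adj_sym : forall x y, adj x y -> adj y x.

Lemma conn_in_mono (A B : V -> Prop) x y :
  (forall v, A v -> B v) -> conn_in adj A x y -> conn_in adj B x y.
Proof.
move=> AB; elim=> [u v [Au [Av uv]]|u|u v w _ IH1 _ IH2].
- by apply: rt_step; do !split => //; apply: AB.
- exact: rt_refl.
- exact: rt_trans IH1 IH2.
Qed.

Lemma conn_in_sym (A : V -> Prop) x y : conn_in adj A x y -> conn_in adj A y x.
Proof.
elim=> [u v [Au [Av uv]]|u|u v w _ IH1 _ IH2].
- by apply: rt_step; do !split => //; apply: adj_sym.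
- exact: rt_refl.
- exact: rt_trans IH2 IH1.
Qed.

Lemma conn_in_ind (A P : V -> Prop) x :
  A x -> P x -> (forall u v, A u -> A v -> adj u v -> P u -> P v) ->
  forall y, conn_in adj A x y -> P y.
Proof.
move=> Ax Px step y /(@clos_rt_rtn1 _ _ _ _); elim=> // u v [Au [Av uv]] _ Pu.
exact: step uv Pu.
Qed.

Lemma connected_set1 x : connected_set adj (fun v => v = x).
Proof. by move=> u v -> ->; apply: rt_refl. Qed.

Lemma connected_setU1 (S : V -> Prop) s z :
  connected_set adj S -> S s -> adj s z -> connected_set adj (fun v => S v \/ v = z).
Proof.
move=> Sc Ss sz.
have to_s v : S v \/ v = z -> conn_in adj (fun v => S v \/ v = z) v s.
  case=> [Sv|->]; first by apply: conn_in_mono (Sc _ _ Sv Ss) => w; left.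
  by apply: rt_step; split; [right | split; [left | apply: adj_sym]].
move=> u v /to_s us /to_s vs; apply: rt_trans us (conn_in_sym vs).
Qed.

Lemma connected_set_seq (p : nat -> V) n :
  (forall i, 0 < i <= n -> exists2 j, j < i & adj (p j) (p i)) ->
  connected_set adj (fun v => exists2 i, i <= n & v = p i).
Proof.
elim: n => [|n IHn] pn.
  move=> u v [[]// _ ->] [[]// _ ->]; exact: rt_refl.
have [j jn pj] := pn n.+1 (leqnn _).
have /connected_setU1/(_ _ pj) : connected_set adj (fun v => exists2 i, i <= n & v = p i).
  by apply: IHn => i ilt; apply: pn; lia.
move=> /(_ (ex_intro2 _ _ j jn erefl)) Sc u v.
have E w : (exists2 i, i <= n.+1 & w = p i) <->
           (exists2 i, i <= n & w = p i) \/ w = p n.+1.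
  split=> [[i]|[[i ilt ->]|->]]; [|by exists i => //; lia|by exists n.+1].
  by rewrite leq_eqVlt => /orP[/eqP -> ->|ilt ->]; [right|left; exists i].
move=> /E Su /E Sv; apply: conn_in_mono (Sc _ _ Su Sv) => w.
by move/E.
Qed.

Lemma finite_set1 (x : V) : finite_set (fun v => v = x).
Proof. by exists [:: x] => v ->; left. Qed.

Lemma finite_setU1 (S : V -> Prop) z : finite_set S -> finite_set (fun v => S v \/ v = z).
Proof. by case=> l Sl; exists (z :: l) => v [/Sl|->]; [right|left]. Qed.

Lemma finite_set_seq (p : nat -> V) n : finite_set (fun v => exists2 i, i <= n & v = p i).
Proof.
exists (map p (iota 0 n.+1)) => v [i ilt ->].
by apply/(@InP {classic V})/map_f; rewrite mem_iota.
Qed.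

End ConnectedSets.

Section Homogeneous.

Variables (V : Type) (adj : V -> V -> Prop) (part : V -> bool).
Hypothesis adj_sym : forall x y, adj x y -> adj y x.
Hypothesis bip : bipartition adj part.

Notation aut := (bip_automorphism adj part).

Lemma adj_part x y : adj x y -> part y = ~~ part x.
Proof. by move/bip; case: (part x); case: (part y). Qed.

Lemma same_part_nadj x y : part x = part y -> ~ adj x y.
Proof. by move=> xy /bip. Qed.

Lemma common_nbr_part x y z : adj x y -> adj y z -> part z = part x.
Proof. by move=> /adj_part xy /adj_part ->; rewrite xy negbK. Qed.

Lemma aut_id : aut id.
Proof. by do !split => //; exists id. Qed.

Lemma aut_comp f g : aut f -> aut g -> aut (g \o f).
Proof.
move=> [[f' [ff' f'f]] [fadj fpart]] [[g' [gg' g'g]] [gadj gpart]]; split; last split.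
- by exists (f' \o g'); split=> x /=; rewrite ?gg' ?f'f.
- by move=> x y; rewrite fadj gadj.
- by move=> x /=; rewrite gpart fpart.
Qed.

Lemma aut_inj f : aut f -> injective f.
Proof. by move=> [[f' [ff' _]] _] x y /(congr1 f'); rewrite !ff'. Qed.

Lemma aut_surj f y : aut f -> exists x, f x = y.
Proof. by move=> [[f' [_ f'f]] _]; exists (f' y). Qed.

Lemma aut_adj f x y : aut f -> adj (f x) (f y) <-> adj x y.
Proof. by move=> [_ [fadj _]]; rewrite -fadj. Qed.

Lemma aut_part f x : aut f -> part (f x) = part x.
Proof. by move=> [_ []]. Qed.

Hypothesis hom : connected_homogeneous_bip adj part.

Lemma transitive_on_parts x y : part x = part y -> exists2 f, aut f & f x = y.
Proof.
move=> xy; have [||||| f [fA fE]] := hom (A := fun v => v = x) (B := fun v => v = y)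
  (f := fun=> y).
- exact: finite_set1.
- exact: finite_set1.
- exact: connected_set1.
- exact: connected_set1.
- split; [|split; [|split; [|split]]] => // [u v -> -> //|v ->|u v -> ->|u ->].
  + by exists x.
  + by split=> /same_part_nadj; case.
  + by [].
by exists f => //; apply: fE.
Qed.

(** The main form of homogeneity: fixing [S] and moving [z] to [z'] is an induced isomorphism
    because both see [S] in the same way. *)
Lemma swap_extends (S : V -> Prop) s z z' :
  finite_set S -> connected_set adj S -> S s -> adj s z -> ~ S z -> ~ S z' ->
  part z = part z' -> (forall v, S v -> adj v z <-> adj v z') ->
  exists2 f, aut f & (forall v, S v -> f v = v) /\ f z = z'.
Proof.
move=> Sfin Sc Ss sz Sz Sz' zz' zadj.
have sz' : adj s z' by apply/zadj.
pose f v := if pselect (v = z) then z' else v.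
have fz : f z = z' by rewrite /f; case: pselect.
have fS v : S v -> f v = v by move=> Sv; rewrite /f; case: pselect => [E|//]; case: Sz; rewrite -E.
have [||||| g [gA gE]] := hom (A := fun v => S v \/ v = z) (B := fun v => S v \/ v = z')
  (f := f).
- exact: finite_setU1.
- exact: finite_setU1.
- exact: connected_setU1 sz.
- exact: connected_setU1 sz'.
- split; [|split; [|split; [|split]]].
  + by move=> v [Sv|->]; [rewrite fS //; left | rewrite fz; right].
  + move=> u v [Su|->] [Sv|->]; rewrite ?fz ?fS // => E; first by case: Sz'; rewrite -E.
    by case: Sz'; rewrite E.
  + by move=> v [Sv|->]; [exists v; split; [left|apply: fS] | exists z; split; [right|]].
  + move=> u v [Su|->] [Sv|->]; rewrite ?fz ?fS //; first exact: zadj.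
      by split=> /adj_sym/zadj-/(_ Sv)/adj_sym.
    by split=> /same_part_nadj; case.
  + by move=> v [Sv|->]; rewrite ?fz ?fS.
by exists g => //; split=> [v Sv|]; [rewrite gE ?fS //; left | rewrite gE ?fz //; right].
Qed.

(** Induction on [n]: once the earlier vertices are matched, [swap_extends] corrects the last one
    with the images already placed held fixed. *)
Lemma seq_extends n (p q : nat -> V) :
  (forall i, i <= n -> part (p i) = part (q i)) ->
  (forall i, 0 < i <= n -> exists2 j, j < i & adj (p j) (p i)) ->
  (forall i j, i <= n -> j <= n -> adj (p i) (p j) <-> adj (q i) (q j)) ->
  (forall i j, i <= n -> j <= n -> p i = p j -> i = j) ->
  (forall i j, i <= n -> j <= n -> q i = q j -> i = j) ->
  exists2 f, aut f & forall i, i <= n -> f (p i) = q i.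
Proof.
elim: n => [|n IHn] pq pc adj_pq pinj qinj.
  by have [f fA fE] := transitive_on_parts (pq 0 isT); exists f => // -[].
have [||||| f fA fE] := IHn.
- by move=> i ilt; apply: pq; lia.
- by move=> i ilt; apply: pc; lia.
- by move=> i j ilt jlt; apply: adj_pq; lia.
- by move=> i j ilt jlt; apply: pinj; lia.
- by move=> i j ilt jlt; apply: qinj; lia.
have [j jn pj] := pc n.+1 (leqnn _).
have [||||||||g gA [gS gE]] := @swap_extends (fun v => exists2 i, i <= n & v = q i) (q j)
  (f (p n.+1)) (q n.+1).
- exact: finite_set_seq.
- apply: connected_set_seq => // i ilt; have [|k ki pk] := pc i; first by lia.
  by exists k => //; apply/adj_pq => //; lia.
- by exists j.
- by rewrite -fE // aut_adj.
- by case=> i ilt; rewrite -fE // => /(aut_inj fA)/pinj E; move: (E (leqnn _) (leqW ilt)); lia.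
- by case=> i ilt /qinj E; move: (E (leqnn _) (leqW ilt)); lia.
- by rewrite aut_part // pq.
- by move=> v [i ilt ->]; rewrite -{1}fE // aut_adj // adj_pq //; lia.
exists (g \o f); first exact: aut_comp.
move=> i; rewrite leq_eqVlt => /orP[/eqP -> //|ilt] /=.
by rewrite fE // gS //; exists i.
Qed.

Lemma degree_on_parts x y d : part x = part y -> has_degree adj x d -> has_degree adj y d.
Proof.
move=> /transitive_on_parts[f fA <-] /has_degreeP[e [inj_e eP]]; apply/has_degreeP.
exists (f \o e); split; first exact: inj_comp (aut_inj fA) inj_e.
move=> w; have [v <-] := aut_surj w fA; rewrite aut_adj // eP.
by split=> -[i E]; exists i; [rewrite /= E | apply: (aut_inj fA) E].
Qed.

End Homogeneous.

(** * Recognising the graphs of the list *)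

Lemma graph_iso_bij (V W : Type) (adjV : V -> V -> Prop) (adjW : W -> W -> Prop)
    (g : W -> V) :
  injective g -> (forall v, exists w, g w = v) ->
  (forall a b, adjW a b <-> adjV (g a) (g b)) -> graph_iso adjV adjW.
Proof.
move=> inj_g /choice[f fP] gadj; exists f, g; split=> //; split=> [y|x y].
  exact/inj_g/fP.
by rewrite gadj !fP.
Qed.

Lemma modn_succ i k : i < k -> (i + 1) %% k = if i.+1 == k then 0 else i.+1.
Proof.
rewrite addn1 => ik; case: eqP => [->|ne]; first exact: modnn.
by rewrite modn_small //; lia.
Qed.

(** The body of [has_cycle] with the length exposed, so that lengths can be compared. *)
Definition is_cycle (V : Type) (adj : V -> V -> Prop) (k : nat) (c : nat -> V) : Prop :=
  3 <= k /\ (forall i j, i < k -> j < k -> c i = c j -> i = j) /\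
  (forall i, i < k -> adj (c i) (c ((i + 1) %% k))).

Section Recognition.

Variables (V : Type) (adj : V -> V -> Prop) (part : V -> bool).
Hypothesis adj_sym : forall x y, adj x y -> adj y x.
Hypothesis adj_irr : forall x, ~ adj x x.
Hypothesis conn : connected_graph adj.

Lemma graph_ind (P : V -> Prop) x :
  P x -> (forall u v, adj u v -> P u -> P v) -> forall y, P y.
Proof.
move=> Px step y; apply: (conn_in_ind (adj := adj) (A := fun=> True) I Px) => [u v _ _|].
  exact: step.
by case: conn => _ /(_ x y I I).
Qed.

(** Between two equal vertices with no closer repetition in between, the walk is injective; having
    no loops and no backtracking excludes gaps 1 and 2. *)
Lemma closed_walk_cycle (c : nat -> V) N i j :
  (forall i, i < N -> adj (c i) (c i.+1)) -> (forall i, i.+1 < N -> c i <> c i.+2) ->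
  i < j <= N -> c i = c j -> exists k d, is_cycle adj k d /\ k <= j - i.
Proof.
move=> cadj cnb; move: {2}(j - i) (leqnn (j - i)) => n.
elim: n i j => [|n IHn] i j jin ij cij; first by lia.
have [[a [b [ab cab]]]|NE] :=
    pselect (exists a b, (i <= a < b /\ b <= j /\ b - a < j - i) /\ c a = c b).
  have [||k [d [kd kab]]] := IHn a b _ _ cab; [lia|lia|].
  by exists k, d; split=> //; lia.
exists (j - i), (fun t => c (i + t)); split=> //; split; last split.
- have : j <> i.+1 by move=> E; apply: (@adj_irr (c i)); rewrite {2}cij E; apply: cadj; lia.
  have : j <> i.+2 by move=> E; apply: (cnb i); [lia | rewrite cij E].
  by lia.
- move=> a b alt blt cab; have [ab|ab|//] := ltngtP a b; case: NE.
    by exists (i + a), (i + b); split=> //; lia.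
  by exists (i + b), (i + a); split=> //; lia.
- move=> t tlt; rewrite modn_succ //; case: eqP => [E|ne]; last first.
    by rewrite addnS; apply: cadj; lia.
  rewrite addn0 cij; have -> : j = (i + t).+1 by lia.
  by apply: cadj; lia.
Qed.

(** A walk that never turns back can be continued forever, and without cycles it never repeats a
    vertex. *)
Lemma acyclic_infinite x0 y0 :
  adj x0 y0 -> (forall x y, adj x y -> exists2 z, adj x z & z <> y) ->
  ~ has_cycle adj -> infinite_type V.
Proof.
move=> xy0 min2 acyc /finite_enumerates[n [e [inj_e eP]]].
have /choice[nx nxP] : forall p : V * V, exists z, adj p.1 p.2 -> adj p.2 z /\ z <> p.1.
  move=> [x y] /=; have [xy|] := pselect (adj x y); last by exists x.
  by have [z] := min2 _ _ (adj_sym xy); exists z.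
(* The state is a directed edge of the walk, so that the next step can avoid the vertex just
   left. *)
pose s m := iter m (fun p => (p.2, nx p)) (x0, y0).
have sadj m : adj (s m).1 (s m).2 by elim: m => //= m /nxP[].
have c_inj i j : i < j -> (s i).1 <> (s j).1.
  move=> ij sij; have [|||//|k [d [kd _]]] := @closed_walk_cycle (fun m => (s m).1) j i j.
  - by move=> m _; exact: (sadj m).
  - by move=> m _ /= E; case: (nxP _ (sadj m)) => _; rewrite E.
  - by rewrite ij leqnn.
  - by apply: acyc; exists k, d.
have /choice[f fP] : forall i : 'I_n.+1, exists j, e j = (s i).1 by move=> i; apply/eP.
have : n.+1 <= n; last by rewrite ltnn.
apply: (@inj_leq _ _ f) => i j /(congr1 e); rewrite !fP => E; apply: val_inj => /=.
by have [/c_inj|/c_inj|//] := ltngtP i j; rewrite E.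
Qed.

(** The two cycle neighbours of [c i] exhaust its neighbours, so the cycle is closed under adjacency
    and is everything by connectedness. *)
Lemma cycle_recognition k (c : nat -> V) :
  3 <= k -> (forall i j, i < k -> j < k -> c i = c j -> i = j) ->
  (forall i, i < k -> adj (c i) (c ((i + 1) %% k))) ->
  (forall v x y z, adj v x -> adj v y -> adj v z -> x <> y -> z = x \/ z = y) ->
  graph_iso adj (@cycle_adj k).
Proof.
move=> k3 cinj cadj max2.
pose prev i := if i == 0 then k.-1 else i.-1.
have prevlt i : i < k -> prev i < k by rewrite /prev; case: eqP; lia.
have prevK i : i < k -> (prev i + 1) %% k = i.
  move=> ik; rewrite modn_succ ?prevlt // /prev; case: (i =P 0) => i0; case: eqP; lia.
have nbr i w : i < k -> adj (c i) w -> w = c ((i + 1) %% k) \/ w = c (prev i).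
  move=> ik iw; apply: (max2 (c i)) => //; first exact: cadj.
    by apply: adj_sym; rewrite -{2}(prevK i) //; apply/cadj/prevlt.
  move=> /cinj E; have := E (ltn_pmod _ _) (prevlt _ ik); rewrite modn_succ // /prev.
  by case: eqP; case: eqP; lia.
apply: (graph_iso_bij (g := fun i : 'I_k => c i)).
- by move=> i j /cinj E; apply/val_inj/E.
- case: conn => -[x] _.
  have k0 : 0 < k by lia.
  apply: (@graph_ind _ (c 0)); first by exists (Ordinal k0).
  move=> u v uv [i E]; subst u; case: (nbr _ _ (ltn_ord i) uv) => ->.
    have lt : (i + 1) %% k < k by rewrite ltn_pmod.
    by exists (Ordinal lt).
  by exists (Ordinal (prevlt _ (ltn_ord i))).
- move=> i j; split=> [[/= ->|/= ->]|].
  + exact: cadj.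
  + exact/adj_sym/cadj.
  + move=> /nbr[] // /cinj E; [left|right]; rewrite /= E ?prevK ?prevlt ?ltn_pmod //; lia.
Qed.

Hypothesis bip : bipartition adj part.

Lemma cycle_even k (c : nat -> V) :
  3 <= k -> (forall i, i < k -> adj (c i) (c ((i + 1) %% k))) -> ~~ odd k.
Proof.
move=> k3 cadj.
have cpart i : i < k -> part (c i) = part (c 0) (+) odd i.
  elim: i => [|i IHi] ik; first by rewrite addbF.
  have := cadj i (ltnW ik); rewrite modn_succ ?(ltnW ik) // ifN_eq; last by lia.
  by move/(adj_part bip) ->; rewrite IHi ?(ltnW ik) //= addbN.
have klt : k.-1 < k by lia.
have := cadj _ klt; rewrite modn_succ // ifT; last by lia.
move=> /(adj_part bip); rewrite (cpart _ klt); case: k k3 klt {cadj cpart} => //= k _ _.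
by case: (part (c 0)); case: (odd k).
Qed.

Hypothesis locfin : locally_finite adj.

Lemma complete_bipartite_recognition :
  (forall x y z w, adj x y -> adj y z -> adj z w -> adj x w) ->
  exists m n, graph_iso adj (@Kmn_adj m n).
Proof.
move=> p4; case: (conn) => -[x0] _.
have opp x y : part y != part x -> adj x y.
  (* The two claims support each other in an induction along a walk from [x]. *)
  have R : (part y = part x -> forall z, adj x z <-> adj y z) /\ (part y <> part x -> adj x y).
    move: y; apply: (@graph_ind _ x); first by [].
    move=> u v uv [Pu Qu]; have pv := adj_part bip uv; split=> E.
      have xu : adj x u by apply: Qu; rewrite -E pv; case: (part u).
      move=> z; split=> [xz|vz].
        exact: p4 (adj_sym uv) (adj_sym xu) xz.
      exact: p4 xu uv vz.
    apply/Pu => //; move: E; rewrite pv; by case: (part u); case: (part x).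
  by move/eqP; case: R.
have fin b : finite_set (fun v => part v = b).
  have [[w wb]|N] := pselect (exists w, part w = ~~ b).
    by have [l lP] := locfin w; exists l => v vb; apply/lP/opp; rewrite vb wb; case: b {vb wb}.
  (* With the opposite part empty there is no edge, so [x0] is the only vertex. *)
  exists [:: x0] => v _; left; move: v; apply: (@graph_ind _ x0) => // u v uv.
  case: N; have := adj_part bip uv.
  by case pu: (part u) => pv; case: (b);
    [exists v | exists u | exists u | exists v].
have [m [e1 [inj1 e1P]]] := finite_enumerates (fin true).
have [n [e2 [inj2 e2P]]] := finite_enumerates (fin false).
have p1 i : part (e1 i) by apply/e1P; exists i.
have p2 i : part (e2 i) = false by apply/e2P; exists i.
exists m, n.
apply: (graph_iso_bij (g := fun s => match s with inl i => e1 i | inr j => e2 j end)).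
- move=> [i|i] [j|j] => [/inj1 -> //|E|E|/inj2 -> //].
    by have := p1 i; rewrite E p2.
  by have := p1 j; rewrite -E p2.
- move=> v; case pv: (part v).
    by have /e1P[i <-] := pv; exists (inl i).
  by have /e2P[i <-] := pv; exists (inr i).
- move=> [i|i] [j|j] /=; split=> // E.
  + by case: (same_part_nadj bip _ E); rewrite !p1.
  + by apply: opp; rewrite p1 p2.
  + by apply: opp; rewrite p1 p2.
  + by case: (same_part_nadj bip _ E); rewrite !p2.
Qed.

(** [eta] picks the unique non-neighbour in the other part; symmetry of non-adjacency makes it an
    involution, which is the removed matching. *)
Lemma cpm_recognition :
  (forall x, exists y, part y <> part x /\ forall z, part z <> part x -> adj x z <-> z <> y) ->
  exists n, graph_iso adj (@cpm_adj n).
Proof.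
case: (conn) => -[x0] _ /choice[eta etaP].
have eta_part x : part (eta x) = ~~ part x.
  by have [] := etaP x; case: (part x); case: (part _).
have eta_adj x z : part z = ~~ part x -> adj x z <-> z <> eta x.
  by move=> pz; apply: (etaP x).2; rewrite pz; case: (part x).
have etaK x : eta (eta x) = x.
  have px : part x = ~~ part (eta x) by rewrite eta_part negbK.
  have [//|ne] := pselect (eta (eta x) = x).
  have /adj_sym xe := (eta_adj _ _ px).2 (nesym ne).
  by case: ((eta_adj _ _ (eta_part x)).1 xe).
have [n [e [inj_e eP]]] : exists n (e : 'I_n -> V), enumerates (fun v => part v = true) e.
  apply: finite_enumerates.
  have [y yP] : exists y, part y = false.
    by case E: (part x0); [exists (eta x0); rewrite eta_part E | exists x0].
  have [l lP] := locfin y; exists (eta y :: l) => v vP.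
  have [->|ne] := pselect (v = eta y); [by left|right].
  by apply/lP/eta_adj => //; rewrite vP yP.
have pe i : part (e i) by apply/eP; exists i.
have inj_eta : injective eta by move=> u v /(congr1 eta); rewrite !etaK.
exists n.
apply: (graph_iso_bij (g := fun s => match s with inl i => e i | inr j => eta (e j) end)).
- move=> [i|i] [j|j] => [/inj_e -> //|E|E|/inj_eta/inj_e -> //].
    by have := pe i; rewrite E eta_part pe.
  by have := pe j; rewrite -E eta_part pe.
- move=> v; case pv: (part v).
    by have /eP[i <-] := pv; exists (inl i).
  have /eP[i E] : part (eta v) by rewrite eta_part pv.
  by exists (inr i); rewrite E etaK.
- have key i j : i <> j <-> adj (e i) (eta (e j)).
    rewrite eta_adj ?eta_part ?pe //.
    by split=> [ij /inj_eta/inj_e/esym //|ne ij]; apply: ne; rewrite ij.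
  move=> [i|i] [j|j] /=.
  + by split=> // E; case: (same_part_nadj bip _ E); rewrite !pe.
  + exact: key.
  + by split=> [/key/adj_sym|/adj_sym/key].
  + by split=> // E; case: (same_part_nadj bip _ E); rewrite !eta_part !pe.
Qed.

End Recognition.

(** * Girth at least 6 *)

Definition degree_ge3 (V : Type) (adj : V -> V -> Prop) (x : V) : Prop :=
  exists a b c, (adj x a /\ adj x b /\ adj x c) /\ (a <> b /\ a <> c /\ b <> c).

Definition C4_free (V : Type) (adj : V -> V -> Prop) : Prop :=
  forall x x' y y', adj x y -> adj x y' -> adj x' y -> adj x' y' -> x = x' \/ y = y'.

Section SquareFree.

Variables (V : Type) (adj : V -> V -> Prop) (part : V -> bool).
Hypothesis adj_sym : forall x y, adj x y -> adj y x.
Hypothesis adj_irr : forall x, ~ adj x x.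
Hypothesis conn : connected_graph adj.
Hypothesis bip : bipartition adj part.
Hypothesis hom : connected_homogeneous_bip adj part.

Lemma degree_ge3_on_parts x y : part x = part y -> degree_ge3 adj x -> degree_ge3 adj y.
Proof.
move=> /(transitive_on_parts bip hom)[f fA <-] [a [b [c [[xa [xb xc]] [ab [ac bc]]]]]].
exists (f a), (f b), (f c); rewrite !(aut_adj _ _ fA).
by split=> //; do !split => //; move/(aut_inj fA).
Qed.

Lemma is_cycle_shift k c : is_cycle adj k c -> is_cycle adj k (fun i => c ((i + 1) %% k)).
Proof.
case=> k3 [cinj cadj]; split=> //; split=> [i j ik jk /cinj E|i ik].
  have /E-/(_ (ltn_pmod _ _)) : (i + 1) %% k < k by rewrite ltn_pmod; lia.
  rewrite !modn_succ // => /(_ ltac:(lia)); case: eqP; case: eqP; lia.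
by apply: cadj; rewrite ltn_pmod; lia.
Qed.

(** Rotating a cycle by one position exchanges the parts along it. *)
Lemma is_cycle_part k c i b :
  is_cycle adj k c -> i < k -> exists2 d, is_cycle adj k d & part (d i) = b.
Proof.
move=> kc ik; have [E|E] := eqVneq (part (c i)) b; first by exists c.
exists (fun i => c ((i + 1) %% k)); first exact: is_cycle_shift.
case: kc => _ [_ /(_ i ik)/(adj_part bip) ->]; by move: E; case: (part _); case: b.
Qed.

Hypothesis c4 : C4_free adj.

Lemma girth_cycle : has_cycle adj ->
  exists g c, [/\ is_cycle adj g c, 6 <= g & forall k d, is_cycle adj k d -> g <= k].
Proof.
move=> [k0 [c0 kc0]].
have ex : exists k, `[<exists c, is_cycle adj k c>] by exists k0; apply/asboolP; exists c0.
case: (ex_minnP ex) => g /asboolP[c gc] gmin; exists g, c; split=> //; last first.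
  by move=> k d kd; apply: gmin; apply/asboolP; exists d.
case: (gc) => g3 [cinj cadj]; have := cycle_even bip g3 cadj.
have : g <> 4.
  move=> E; subst g; have [] := @c4 (c 0) (c 2) (c 1) (c 3).
  - exact: (cadj 0).
  - exact/adj_sym/(cadj 3).
  - exact/adj_sym/(cadj 1).
  - exact: (cadj 2).
  - by move/cinj => /(_ isT isT).
  - by move/cinj => /(_ isT isT).
by move: g3; case: g {gc gmin cinj cadj} => [|[|[|[|[|[|]]]]]].
Qed.

(** Otherwise the arc from [c i] to [c (g - 3)], closed through [w], is a non-backtracking closed
    walk of length [g - 1 - i] and contains a cycle shorter than [g]. *)
Lemma no_shortcut g c w i :
  is_cycle adj g c -> (forall k d, is_cycle adj k d -> g <= k) -> 6 <= g ->
  adj (c (g - 3)) w -> w <> c (g - 4) -> i <= g - 4 -> ~ adj (c i) w.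
Proof.
move=> [g3 [cinj cadj]] gmin g6 cw wne ig iw.
pose d t := if t < g - 2 - i then c (i + t) else if t == g - 2 - i then w else c i.
have cadj' t : t.+1 < g -> adj (c t) (c t.+1).
  by move=> tg; have := cadj t; rewrite modn_succ ?ifN_eq; [apply|..]; lia.
have cne t : t.+2 < g -> c t <> c t.+2 by move=> tg /cinj E; have := E; lia.
have [||||k [e [ke]]] := @closed_walk_cycle _ _ adj_irr d (g - 1 - i) 0 (g - 1 - i).
- move=> t tlt; rewrite /d; case: ltnP => tl; case: ltnP => tl'.
  + by rewrite addnS; apply: cadj'; lia.
  + by rewrite ifT; [have -> : i + t = g - 3 by lia | lia].
  + by lia.
  + by rewrite ifT ?ifF; [apply: adj_sym | lia | lia].
- move=> t tlt; rewrite /d; case: ltnP => tl; case: ltnP => tl'.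
  + by rewrite !addnS; apply: cne; lia.
  + case: eqP => E; first by have -> : i + t = g - 4 by [lia]; apply: nesym.
    by move/cinj => E'; have := E'; lia.
  + by lia.
  + by lia.
- by lia.
- rewrite /d; case: ltnP => tl; last by lia.
  case: ltnP => tl'; first by lia.
  by rewrite ifF ?addn0 //; lia.
- by move/gmin: ke; lia.
Qed.

(** On a shortest cycle, the arc from [c 0] to [c (g - 3)] is fixed while [c (g - 2)] is moved to a
    neighbour [w] of [c (g - 3)] off the cycle arc. The old and new routes from [c (g - 3)] to [c 0]
    have length 3 each and close up in 6 steps, so [g] is at most 6. *)
Lemma six_cycle u : has_cycle adj -> degree_ge3 adj u -> exists c, is_cycle adj 6 c.
Proof.
move=> /girth_cycle[g [c0 [gc0 g6 gmin]]] deg_u.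
have [|c gc pc] := @is_cycle_part g c0 (g - 3) (part u) gc0; first by lia.
have [g3 [cinj cadj]] := gc.
have cadj' t : t.+1 < g -> adj (c t) (c t.+1).
  by move=> tg; have := cadj t; rewrite modn_succ ?ifN_eq; [apply|..]; lia.
have cadj0 : adj (c g.-1) (c 0).
  by have := cadj g.-1; rewrite modn_succ ?ifT; [apply|..]; lia.
have c32 : adj (c (g - 3)) (c (g - 2)).
  by have := cadj' (g - 3); rewrite (_ : (g - 3).+1 = g - 2); [apply|]; lia.
have c21 : adj (c (g - 2)) (c g.-1).
  by have := cadj' (g - 2); rewrite (_ : (g - 2).+1 = g.-1); [apply|]; lia.
have cne s t : s < g -> t < g -> s <> t -> c s <> c t.
  by move=> sg tg st /cinj E; apply: st; apply: E.
have [w [cw w4 w2]] : exists w, [/\ adj (c (g - 3)) w, w <> c (g - 4) & w <> c (g - 2)].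
  have [a [b [d [[xa [xb xd]] [ab [ad bd]]]]]] := degree_ge3_on_parts (esym pc) deg_u.
  have [[a4|a4] [a2|a2]] := (pselect (a = c (g - 4)), pselect (a = c (g - 2))).
  - by case: (cne (g - 4) (g - 2)); rewrite -?a4 -?a2 //; lia.
  - have [b2|b2] := pselect (b = c (g - 2)).
      by exists d; split=> //; rewrite -?a4 -?b2; apply: nesym.
    by exists b; split=> //; rewrite -a4; apply: nesym.
  - have [b4|b4] := pselect (b = c (g - 4)).
      by exists d; split=> //; rewrite -?b4 -?a2; apply: nesym.
    by exists b; split=> //; rewrite -a2; apply: nesym.
  - by exists a.
have wS i : i <= g - 3 -> w <> c i.
  move=> ig E; have [Ei|[Ei|Ei]] : i = g - 3 \/ i = g - 4 \/ i < g - 4 by lia.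
  - by apply: (@adj_irr w); rewrite {1}E Ei.
  - by apply: w4; rewrite E Ei.
  - apply: (@no_shortcut g c w i.+1) => //.
    by rewrite E; apply/adj_sym/cadj'; lia.
have [||||||||f fA [fS fz]] := @swap_extends _ _ _ adj_sym bip hom
    (fun v => exists2 i, i <= g - 3 & v = c i) (c (g - 3)) (c (g - 2)) w.
- exact: finite_set_seq.
- apply: connected_set_seq => // -[|i] // ig; exists i => //; apply: cadj'; lia.
- by exists (g - 3).
- by [].
- by case=> i ig; apply: cne; lia.
- by case=> i /wS.
- by rewrite (adj_part bip cw) (adj_part bip c32).
- move=> v [i ig ->]; have [->|ne] := eqVneq i (g - 3); first by [].
  have i4 : i <= g - 4 by lia.
  have c24 : c (g - 2) <> c (g - 4) by apply: cne; lia.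
  split=> E; first by case: (no_shortcut gc gmin g6 c32 c24 i4 E).
  by case: (no_shortcut gc gmin g6 cw w4 i4 E).
have f0 : f (c 0) = c 0 by apply: fS; exists 0.
have f3 : f (c (g - 3)) = c (g - 3) by apply: fS; exists (g - 3).
pose d t := nth (c 0) [:: c 0; c g.-1; c (g - 2); c (g - 3); w; f (c g.-1); c 0] t.
have [||||k [e [ke k6]]] := @closed_walk_cycle _ _ adj_irr d 6 0 6.
- move=> [|[|[|[|[|[|]]]]]] //= _; rewrite /d /=.
  + exact: adj_sym.
  + exact: adj_sym.
  + exact: adj_sym.
  + by rewrite -fz; apply/(aut_adj _ _ fA).
  + by rewrite -f0; apply/(aut_adj _ _ fA).
- move=> [|[|[|[|[|]]]]] //= _; rewrite /d /=.
  + by apply: cne; lia.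
  + by apply: cne; lia.
  + exact: nesym.
  + by rewrite -{1}f3 => /(aut_inj fA); apply: cne; lia.
  + exact: wS.
- by [].
- by [].
by have gk := gmin _ _ ke; exists c; have <- : g = 6 by lia.
Qed.

(** * Paths of length 4 and the projective plane *)

Definition nonbacktracking4 (p : nat -> V) : Prop :=
  (forall i, i < 4 -> adj (p i) (p i.+1)) /\ (forall i, i < 3 -> p i <> p i.+2).

Lemma path4_part p i : nonbacktracking4 p -> i <= 4 -> part (p i) = part (p 0) (+) odd i.
Proof.
move=> [padj _]; elim: i => [|i IHi] i4; first by rewrite addbF.
by rewrite (adj_part bip (padj i i4)) IHi ?(ltnW i4) //= addbN.
Qed.

(** The parts settle most pairs; vertices three steps apart are not adjacent, as this would be a
    4-cycle, and this also separates the two ends. *)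
Lemma path4_induced p i j : nonbacktracking4 p -> i < j <= 4 ->
  p i <> p j /\ (adj (p i) (p j) <-> j = i.+1).
Proof.
move=> pP ij; have pi := path4_part (i := i) pP; have pj := path4_part (i := j) pP.
case: (pP) => padj pne.
have no4 t : t + 3 <= 4 -> ~ adj (p t) (p (t + 3)).
  rewrite !addnS addn0 => t4 pt; have [||||E|E] := @c4 (p t) (p t.+2) (p t.+1) (p t.+3) => //.
  - by apply: padj; lia.
  - by apply/adj_sym/padj; lia.
  - by apply: padj; lia.
  - by apply: (pne t) E; lia.
  - by apply: (pne t.+1) E; lia.
have same : part (p i) = part (p j) -> ~ adj (p i) (p j) by apply: same_part_nadj.
have [E|[E|[E|E]]] : j = i.+1 \/ j = i.+2 \/ j = i + 3 \/ j = i + 4 by lia.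
- subst j; split; last by split=> // _; apply: padj; lia.
  by move=> E; apply: (@adj_irr (p i)); rewrite {2}E; apply: padj; lia.
- subst j; split; first by apply: pne; lia.
  split=> [/same|]; last by lia.
  by case; rewrite pi ?pj /=; try lia; rewrite negbK.
- subst j; split; last by split=> [/no4|]; lia.
  move=> E; have : part (p i) = part (p (i + 3)) by rewrite -E.
  have i4 : i <= 4 by lia.
  have j4 : i + 3 <= 4 by lia.
  by rewrite (pi i4) (pj j4) oddD; case: (part _); case: (odd i).
- subst j; have i0 : i = 0 by lia.
  subst i; rewrite add0n in pj same *; split.
    move=> E; apply: (no4 0) => //=; apply: adj_sym; rewrite E; exact: (padj 3).
  split=> [/same|//]; by rewrite pj //= addbF.
Qed.

(** Homogeneity carries a four-step path on the 6-cycle to the given one; the sixth vertex of the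
    cycle goes to the required [u]. *)
Lemma path4_closes c v0 v1 v2 v3 v4 : is_cycle adj 6 c ->
  adj v0 v1 -> adj v1 v2 -> adj v2 v3 -> adj v3 v4 -> v0 <> v2 -> v1 <> v3 -> v2 <> v4 ->
  exists2 u, adj v0 u & adj u v4.
Proof.
move=> c6 a01 a12 a23 a34 n02 n13 n24.
have {c c6}[c [_ [cinj cadj]] pc] := is_cycle_part (part v0) c6 (isT : 0 < 6).
pose q := nth v0 [:: v0; v1; v2; v3; v4].
have cP : nonbacktracking4 c.
  split=> i i4; first by have := cadj i; rewrite modn_succ ?ifN_eq; [apply|..]; lia.
  by move=> /cinj E; have := E; lia.
have qP : nonbacktracking4 q by split=> -[|[|[|[|]]]].
have [|||||f fA fE] := @seq_extends _ _ _ adj_sym bip hom 4 c q.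
- by move=> i i4; rewrite (path4_part cP) // (path4_part qP) // pc.
- by move=> [|i] // i4; exists i => //; apply: cP.1.
- move=> i j i4 j4; have [ij|ij|->] := ltngtP i j; last by split=> /adj_irr.
    have [|_ ->] := @path4_induced c i j cP; first by lia.
    by have [|_ ->] := @path4_induced q i j qP; first by lia.
  have [|_ E1] := @path4_induced c j i cP; first by lia.
  have [|_ E2] := @path4_induced q j i qP; first by lia.
  by split=> /adj_sym H; apply: adj_sym; [apply/E2/E1 | apply/E1/E2].
- by move=> i j i4 j4; apply: cinj; lia.
- move=> i j i4 j4 qij; have [ij|ij|//] := ltngtP i j.
    by have [|/(_ qij)] := @path4_induced q i j qP; first by lia.
  by have [|/(_ (esym qij))] := @path4_induced q j i qP; first by lia.
exists (f (c 5)).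
  by rewrite -[v0]/(q 0) -fE //; apply/(aut_adj _ _ fA)/adj_sym/(cadj 5).
by rewrite -[v4]/(q 4) -fE //; apply/(aut_adj _ _ fA)/adj_sym/(cadj 4).
Qed.

Lemma two_step_diameter c x y : is_cycle adj 6 c -> part y = part x ->
  y = x \/ exists2 z, adj x z & adj z y.
Proof.
(* For the induction along edges the claim is extended to the other part: such a vertex has a
   neighbour already within two steps of [x]. *)
move=> c6; suff : (part y = part x -> y = x \/ exists2 z, adj x z & adj z y) /\
  (part y <> part x -> exists2 t, adj y t & t = x \/ exists2 z, adj x z & adj z t) by case.
move: y; apply: (@graph_ind _ _ conn _ x) => [|u v uv [Pu Qu]].
  by split=> // _; left.
have pv := adj_part bip uv; split=> E; last first.
  exists u; first exact: adj_sym.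
  by apply: Pu; move: E; rewrite pv; case: (part u); case: (part x).
have [|t ut [Et|[z xz zt]]] := Qu; first by rewrite -E pv; case: (part u).
  by right; exists u => //; apply: adj_sym; rewrite -Et.
have [zu|zu] := pselect (z = u); first by right; exists u => //; rewrite -zu.
have [tv|tv] := pselect (t = v); first by right; exists z => //; rewrite -tv.
have [xt|xt] := pselect (x = t); first by right; exists u => //; apply: adj_sym; rewrite xt.
by right; apply: (path4_closes c6 xz zt (adj_sym ut) uv).
Qed.

Hypothesis min2 : forall x y, adj x y -> exists2 z, adj x z & z <> y.

(* Points and lines of a projective plane: any two same-part vertices have exactly one
   common neighbour once the girth is 6 and paths of length 4 close up. *)
Lemma degree_ge3_everywhere c u v :
  is_cycle adj 6 c -> degree_ge3 adj u -> degree_ge3 adj v.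
Proof.
move=> c6 deg_u.
have [E|E] := eqVneq (part u) (part v); first exact: degree_ge3_on_parts deg_u.
case: (deg_u) => l1 [l2 [l3 [[u1 [u2 u3]] [l12 [l13 l23]]]]].
(* Take [u] as a point on the lines [l1], [l2], [l3]. The line [m] joining points [q1] of [l1] and
   [q2] of [l2] misses [u] and meets [l3] in a third point [r]. *)
have [q1 l1q nq1] := min2 (adj_sym u1).
have [q2 l2q nq2] := min2 (adj_sym u2).
have q12 : q2 <> q1.
  move=> F; rewrite F in l2q; case: (@c4 u q1 l1 l2) => //; try exact: adj_sym.
  by move/esym.
have pq : part q2 = part q1.
  by rewrite (common_nbr_part bip u1 l1q) (common_nbr_part bip u2 l2q).
have [//|[m q1m mq2]] := two_step_diameter c6 pq.
have pm : part l3 = part m.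
  by rewrite (adj_part bip q1m) (common_nbr_part bip u1 l1q) (adj_part bip u3).
have um : ~ adj u m.
  move=> um; case: (@c4 u q1 l1 m) => //; try exact: adj_sym.
    by move/esym.
  move=> F; case: (@c4 u q2 l2 m) => //; try exact: adj_sym.
    by move/esym.
  by move=> G; apply: l12; rewrite F G.
have [F|[r mr rl]] := two_step_diameter c6 pm; first by case: um; rewrite -F.
have ru : r <> u by move=> F; apply: um; apply: adj_sym; rewrite -F.
apply: (@degree_ge3_on_parts m).
  by rewrite -pm (adj_part bip u3); move: E; case: (part u); case: (part v).
have nr q l : adj u l -> adj l q -> q <> u -> l <> l3 -> q <> r.
  move=> ul lq qu ll3 F; case: (@c4 u q l l3) => //; try exact: adj_sym.
  - by rewrite F; apply: adj_sym; apply: adj_sym.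
  - by move/esym.
exists q1, q2, r; split; first by do !split => //; apply: adj_sym.
by split; [exact: nesym | split; [apply: (nr _ l1) | apply: (nr _ l2)]].
Qed.

(* Given three points p0, p1, p2 of a line l and further lines m0, m1 through p0, p1, the
   line through p2 and the intersection q of m0, m1 and another line through p2 extend the
   same configuration, yet only the former passes through q. *)
Lemma square_free_acyclic u : degree_ge3 adj u -> ~ has_cycle adj.
Proof.
move=> deg_u cyc; have [c c6] := six_cycle cyc deg_u.
case: (deg_u) => p0 [p1 [p2 [[l0 [l1 l2]] [p01 [p02 p12]]]]]; set l := u in l0 l1 l2.
have [m0 pm0 ml0] := min2 (adj_sym l0).
have [m1 pm1 ml1] := min2 (adj_sym l1).
have off p p' m : adj l p -> adj l p' -> p <> p' -> m <> l -> adj p m -> ~ adj p' m.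
  move=> lp lp' pp' ml pm p'm; case: (@c4 l m p p') => //; try exact: adj_sym.
  by move/esym.
have pl m p : adj l p -> adj p m -> part m = part l by apply: common_nbr_part.
have pml0 := pl _ _ l0 pm0; have pml1 := pl _ _ l1 pm1.
have m01 : m1 <> m0 by move=> F; apply: (off _ _ _ l1 l0 (nesym p01) ml1 pm1); rewrite F.
have [//|[q m0q qm1]] := two_step_diameter c6 (etrans pml1 (esym pml0)).
have lq : ~ adj l q.
  move=> lq; have [E|ne] := pselect (p0 = q).
    by apply: (off _ _ _ l1 l0 (nesym p01) ml1 pm1); rewrite E.
  exact: (off _ _ _ l0 lq ne ml0 pm0 (adj_sym m0q)).
have pq : part q = part p2.
  by rewrite (common_nbr_part bip pm0 m0q) (adj_part bip l0) (adj_part bip l2).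
have [E|[m2 pm2 m2q]] := two_step_diameter c6 pq; first by case: lq; rewrite E.
have ml2 : m2 <> l by move=> E; apply: lq; rewrite -E.
(* At least three lines pass through [p2]; one other than [l] and [m2] cannot also contain [q]. *)
have [m2' [pm2' ml2' m22']] : exists m2', [/\ adj p2 m2', m2' <> l & m2' <> m2].
  have [a [b [d [[xa [xb xd]] [ab [ad bd]]]]]] := degree_ge3_everywhere p2 c6 deg_u.
  have [[al|al] [am|am]] := (pselect (a = l), pselect (a = m2)).
  - by case: ml2; rewrite -al -am.
  - have [bm|bm] := pselect (b = m2).
      by exists d; split=> //; rewrite -?al -?bm; apply: nesym.
    by exists b; split=> //; rewrite -al; apply: nesym.
  - have [bl|bl] := pselect (b = l).
      by exists d; split=> //; rewrite -?bl -?am; apply: nesym.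
    by exists b; split=> //; rewrite -am; apply: nesym.
  - by exists a.
have qm2' : ~ adj m2' q.
  move=> m2'q; case: (@c4 m2' m2 p2 q) => //; try exact: adj_sym.
  by move=> E; apply: lq; rewrite -E.
pose s := nth l [:: l; p0; p1; p2; m0; m1].
have notS m : part m = part l -> adj p2 m -> m <> l -> ~ exists2 i, i <= 5 & m = s i.
  move=> pm p2m ml [[|[|[|[|[|[|i]]]]]]] // _; rewrite /s /= => E //.
  - by have := adj_part bip l0; rewrite -E pm; case: (part l).
  - by have := adj_part bip l1; rewrite -E pm; case: (part l).
  - by have := adj_part bip l2; rewrite -E pm; case: (part l).
  - by apply: (off _ _ _ l0 l2 p02 ml0 pm0); rewrite -E.
  - by apply: (off _ _ _ l1 l2 p12 ml1 pm1); rewrite -E.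
have pm2l := pl _ _ l2 pm2; have pm2l' := pl _ _ l2 pm2'.
have [||||||||f fA [fS fz]] := @swap_extends _ _ _ adj_sym bip hom
    (fun v => exists2 i, i <= 5 & v = s i) p2 m2 m2'.
- exact: finite_set_seq.
- apply: connected_set_seq => // -[|[|[|[|[|[|i]]]]]] // _; rewrite /s /=.
  + by exists 0.
  + by exists 0.
  + by exists 0.
  + by exists 1.
  + by exists 2.
- by exists 3.
- by [].
- exact: notS.
- exact: notS.
- by rewrite pm2l pm2l'.
- move=> v [i i5 ->]; have same w : part w = part l -> adj w m2 <-> adj w m2'.
    by move=> pw; split=> E; case: (same_part_nadj bip _ E); rewrite pw ?pm2l ?pm2l'.
  case: i i5 => [|[|[|[|[|[|i]]]]]] // _; rewrite /s /=; try exact: same.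
  + by split=> E; case: (off p0 p2 _ l0 l2 p02 _ E).
  + by split=> E; case: (off p1 p2 _ l1 l2 p12 _ E).
have f0 : f m0 = m0 by apply: fS; exists 4.
have f1 : f m1 = m1 by apply: fS; exists 5.
(* [q] is the only common point of the fixed lines [m0] and [m1]; being fixed, it would lie on the
   image [m2'] of [m2]. *)
have fq : f q = q.
  case: (@c4 m0 m1 (f q) q) => //.
  - by rewrite -f0; apply/(aut_adj _ _ fA).
  - by rewrite -f1; apply/(aut_adj _ _ fA)/adj_sym.
  - exact: adj_sym.
  - by move/esym.
by apply: qm2'; rewrite -fz -fq; apply/(aut_adj _ _ fA).
Qed.

End SquareFree.

(** * Graphs with 4-cycles *)

(** For a connected bipartite graph this says that the graph is complete bipartite. *)
Definition P4_closed (V : Type) (adj : V -> V -> Prop) : Prop :=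
  forall x y z w, adj x y -> adj y z -> adj z w -> adj x w.

Section Squares.

Variables (V : Type) (adj : V -> V -> Prop) (part : V -> bool).
Hypothesis adj_sym : forall x y, adj x y -> adj y x.
Hypothesis adj_irr : forall x, ~ adj x x.
Hypothesis conn : connected_graph adj.
Hypothesis bip : bipartition adj part.
Hypothesis hom : connected_homogeneous_bip adj part.

Notation aut := (bip_automorphism adj part).

(** Paths of length 2 are induced, since their ends lie in the same part. *)
Lemma path2_extends x y x' u v u' :
  adj x y -> adj y x' -> x <> x' -> adj u v -> adj v u' -> u <> u' -> part x = part u ->
  exists2 f, aut f & [/\ f x = u, f y = v & f x' = u'].
Proof.
move=> xy yx' xx' uv vu' uu' xu.
have px := common_nbr_part bip xy yx'; have pu := common_nbr_part bip uv vu'.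
have py := adj_part bip xy; have pv := adj_part bip uv.
have nx : ~ adj x x' by apply: (same_part_nadj bip).
have nu : ~ adj u u' by apply: (same_part_nadj bip).
have ne a b : adj a b -> a <> b by move=> ab E; apply: (@adj_irr a); rewrite {2}E.
have nes a b : adj a b -> b <> a by move/adj_sym/ne.
pose p := nth x [:: x; y; x']; pose q := nth u [:: u; v; u'].
have [|||||f fA fE] := @seq_extends _ _ _ adj_sym bip hom 2 p q.
- by case=> [|[|[|]]] //= _; rewrite ?py ?pv ?px ?pu xu.
- by case=> [|[|[|]]] // _; [exists 0 | exists 1].
- have nx' : ~ adj x' x by move/adj_sym.
  have nu' : ~ adj u' u by move/adj_sym.
  by case=> [|[|[|i]]] // [|[|[|j]]] // _ _; rewrite /p /q /=; split=> E //;
     solve [case: (adj_irr E) | exact: adj_sym].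
- case=> [|[|[|i]]] // [|[|[|j]]] // _ _; rewrite /p /= => E //; exfalso; move: E;
    solve [exact: ne | exact: nes | exact: xx' | exact: (nesym xx')].
- case=> [|[|[|i]]] // [|[|[|j]]] // _ _; rewrite /q /= => E //; exfalso; move: E;
    solve [exact: ne | exact: nes | exact: uu' | exact: (nesym uu')].
exists f => //; split; [exact: (fE 0) | exact: (fE 1) | exact: (fE 2)].
Qed.

(** A vertex and its neighbours induce a star, whose leaves may be permuted at will; the stabiliser
    of [x] thus induces the full symmetric group on its neighbours. *)
Lemma star_extends x n (e : 'I_n -> V) (p : {perm 'I_n}) :
  enumerates (adj x) e -> exists2 f, aut f & f x = x /\ forall i, f (e i) = e (p i).
Proof.
move=> [inj_e eP]; have xe i : adj x (e i) by apply/eP; exists i.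
have ex v : exists w, (forall i, v = e i -> w = e (p i)) /\ (v = x -> w = x).
  have [/eP[i <-]|nv] := pselect (adj x v).
    exists (e (p i)); split=> [j /inj_e -> //|E].
    by case: (@adj_irr x); rewrite -{2}E.
  by exists v; split=> [i E|//]; case: nv; rewrite E.
have {ex}[h hP] := choice ex.
have he i : h (e i) = e (p i) by apply: (hP _).1.
have hx : h x = x by apply: (hP _).2.
pose S v := v = x \/ adj x v.
have Sfin : finite_set S.
  have [l lP] := enumerates_finite (conj inj_e eP).
  by exists (x :: l) => v [->|/lP]; [left|right].
have Sc : connected_set adj S.
  have to_x v : S v -> conn_in adj S v x.
    case=> [->|xv]; first exact: rt_refl.
    by apply: rt_step; split; [right | split; [left | exact: adj_sym]].
  by move=> u v /to_x ux /to_x vx; apply: rt_trans ux (conn_in_sym adj_sym vx).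
have pxe i : part (e i) = ~~ part x by rewrite (adj_part bip (xe i)).
have nee i j : ~ adj (e i) (e j) by apply: (same_part_nadj bip); rewrite !pxe.
have nxe i : x <> e i by move=> E; apply: (@adj_irr x); rewrite {2}E.
have [|f [fA fE]] := hom Sfin Sfin Sc Sc (f := h).
  split; [|split; [|split; [|split]]].
  - by move=> v [->|/eP[i <-]]; [left | right; rewrite he].
  - move=> u v [->|/eP[i <-]] [->|/eP[j <-]] //; rewrite ?hx ?he.
    + by move/nxe.
    + by move/esym/nxe.
    + by move/inj_e/perm_inj => ->.
  - move=> v [->|/eP[i <-]]; first by exists x; split; [left|].
    by exists (e ((p^-1)%g i)); rewrite he permKV; split=> //; right.
  - move=> u v [->|/eP[i <-]] [->|/eP[j <-]] //; rewrite ?hx ?he.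
    + by [].
    + by split.
    + by split=> _; apply: adj_sym.
    + by split=> /nee.
  - by move=> v [->|/eP[i <-]]; rewrite ?hx ?he ?pxe.
exists f => //; split=> [|i]; first by rewrite fE //; left.
by rewrite fE //; right.
Qed.

Hypothesis locfin : locally_finite adj.
Hypothesis not_p4 : ~ P4_closed adj.

(** If [y] were the only neighbour, transitivity would give every vertex in the part of [x] at most
    one neighbour; every three-step walk would backtrack and [P4_closed] would hold. *)
Lemma nonleaf x y : adj x y -> exists2 z, adj x z & z <> y.
Proof.
move=> xy; apply: contrapT => N; apply: not_p4.
have one x' z1 z2 : part x' = part x -> adj x' z1 -> adj x' z2 -> z1 = z2.
  move=> /esym/(transitive_on_parts bip hom)[f fA <-].
  have [w1 <-] := aut_surj z1 fA; have [w2 <-] := aut_surj z2 fA.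
  rewrite !(aut_adj _ _ fA) => xw1 xw2; congr f.
  have [->|n1] := pselect (w1 = y); last by case: N; exists w1.
  by have [->|n2] := pselect (w2 = y) => //; case: N; exists w2.
move=> a b c d ab bc cd; have [E|E] := eqVneq (part b) (part x).
  by rewrite (one b a c E (adj_sym ab) bc).
rewrite -(one c b d _ (adj_sym bc) cd) //.
by rewrite (adj_part bip bc); move: E; case: (part b); case: (part x).
Qed.

Lemma has_nbr x : exists y, adj x y.
Proof.
have [a [b ab]] : exists a b, adj a b.
  by apply: contrapT => N; apply: not_p4 => a b *; case: N; exists a, b.
have [E|E] := eqVneq (part a) (part x).
  by have [f fA <-] := transitive_on_parts bip hom E; exists (f b); apply/(aut_adj _ _ fA).
have [|f fA <-] := @transitive_on_parts _ _ _ bip hom b x.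
  by rewrite (adj_part bip ab); move: E; case: (part a); case: (part x).
by exists (f a); apply/(aut_adj _ _ fA)/adj_sym.
Qed.

(** Otherwise [path2_extends] spreads the inclusion to all pairs in this part with a common
    neighbour, which forces [P4_closed]. *)
Lemma nbr_not_included x x' y :
  adj x y -> adj x' y -> x <> x' -> exists2 z, adj x z & ~ adj x' z.
Proof.
move=> xy x'y xx'; apply: contrapT => N; apply: not_p4.
have incl u v u' w : part u = part x -> u <> u' -> adj u v -> adj v u' -> adj u w -> adj u' w.
  move=> pu uu' uv vu'.
  have [|f fA [<- _ <-]] := path2_extends xy (adj_sym x'y) xx' uv vu' uu'; first by [].
  have [z <-] := aut_surj w fA; rewrite !(aut_adj _ _ fA) => xz.
  by apply: contrapT => x'z; apply: N; exists z.
move=> a b c d ab bc cd; have [E|E] := eqVneq (part c) (part x).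
  have [ca|ca] := pselect (c = a); first by rewrite -ca.
  by apply: (incl c b) cd => //; apply: adj_sym.
have [<-//|bd] := pselect (b = d).
apply: adj_sym; apply: (incl b c d a) => //; last exact: adj_sym.
by move: E; rewrite (adj_part bip bc); case: (part b); case: (part x).
Qed.

Hypothesis square : ~ C4_free adj.

(** A 4-cycle contains paths of length 2 starting in either part; one is carried onto [x], [y],
    [x'], and its fourth vertex gives the second common neighbour. *)
Lemma second_common_nbr x x' y : adj x y -> adj x' y -> x <> x' ->
  exists2 z, z <> y & adj x z /\ adj x' z.
Proof.
move=> xy x'y xx'.
have [a [a' [b [b' [[[ab ab'] [a'b a'b']] [aa' bb']]]]]] : exists a a' b b',
    ((adj a b /\ adj a b') /\ (adj a' b /\ adj a' b')) /\ (a <> a' /\ b <> b').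
  apply: contrapT => N; apply: square => a a' b b' ab ab' a'b a'b'.
  apply: contrapT => /not_orP ne; apply: N.
  by exists a, a', b, b'.
have fin u v u' v' : part u = part x -> adj u v -> adj v u' -> adj u v' -> adj u' v' ->
    u <> u' -> v <> v' -> exists2 z, z <> y & adj x z /\ adj x' z.
  move=> pu uv vu' uv' u'v' uu' vv'.
  have [|f fA [<- <- <-]] := path2_extends uv vu' uu' xy (adj_sym x'y) xx'; first by [].
  by exists (f v'); [move/(aut_inj fA)/esym | rewrite !(aut_adj _ _ fA)].
have [E|E] := eqVneq (part a) (part x).
  exact: (fin a b a' b' E ab (adj_sym a'b) ab' a'b' aa' bb').
have E' : part b = part x.
  by rewrite (adj_part bip ab); move: E; case: (part a); case: (part x).
exact: (fin b a b' a' E' (adj_sym ab) ab' (adj_sym a'b) (adj_sym a'b') bb' aa').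
Qed.

(** This and [at_most_two_common] are the cases [k = a - 1] and [k = 2] of the count below, phrased
    without cardinals. *)
Definition misses_at_most_one x x' : Prop :=
  forall z1 z2, adj x z1 -> adj x z2 -> ~ adj x' z1 -> ~ adj x' z2 -> z1 = z2.

Definition at_most_two_common x x' : Prop :=
  forall z1 z2 z3, adj x z1 -> adj x z2 -> adj x z3 -> adj x' z1 -> adj x' z2 -> adj x' z3 ->
  z1 = z2 \/ z1 = z3 \/ z2 = z3.

(* The stabiliser of x permutes N(x) arbitrarily, so with k common neighbours of x and x'
   every k-subset of N(x) containing y is N(x) :&: N(x'') for some x'' in N(y); and
   'C(a - 1, k - 1) >= a - 1 for 2 <= k < a. *)
Lemma common_nbr_count x y a b (e : 'I_a -> V) (e' : 'I_b -> V) :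
  adj x y -> enumerates (adj x) e -> enumerates (adj y) e' ->
  a <= b /\ (b <= a ->
    (forall u v, adj y u -> adj y v -> (forall w, adj x w -> adj u w <-> adj v w) -> u = v) /\
    (forall x', adj y x' -> x <> x' -> misses_at_most_one x x' \/ at_most_two_common x x')).
Proof.
move=> xy eP e'P; have [inj_e eE] := eP; have [inj_e' e'E] := e'P.
have [j0 ej0] : exists j, e j = y by apply/eE.
pose nb v := [set j | `[<adj v (e j)>]].
have nbE v j : (j \in nb v) = `[<adj v (e j)>] by rewrite inE.
(* The traces left on the neighbourhood of [x] by the neighbours of [y]; all contain [j0], the index
   of [y]. *)
pose G := [set nb (e' i) | i : 'I_b].
have GP v : adj y v -> nb v \in G by move/e'E=> [i <-]; apply: imset_f.
have bounds x' : adj y x' -> x <> x' -> 1 < #|nb x'| < a.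
  move=> yx' xx'; have x'y := adj_sym yx'.
  have [z zy [xz x'z]] := second_common_nbr xy x'y xx'.
  have [w xw x'w] := nbr_not_included xy x'y xx'.
  have [jz ejz] : exists j, e j = z by apply/eE.
  have [jw ejw] : exists j, e j = w by apply/eE.
  apply/andP; split.
    have <- : #|[set j0; jz]| = 2.
      rewrite cards2; case: eqP => // F; case: zy; by rewrite -ejz -F ej0.
    apply/subset_leq_card/subsetP => j; rewrite !inE => /orP[]/eqP->; apply/asboolP.
      by rewrite ej0.
    by rewrite ejz.
  rewrite -[X in _ < X]card_ord -cardsT; apply: proper_card.
  rewrite properT; apply/eqP => /setP/(_ jw); rewrite nbE !inE => /asboolP.
  by rewrite ejw.
(* A permutation fixing [j0] and taking one trace to [B] is realised by an automorphism fixing [x]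
   and [y]. *)
have all x' (B : {set 'I_a}) : adj y x' -> j0 \in B -> #|B| = #|nb x'| -> B \in G.
  move=> yx' j0B cB.
  have [|p [pj0 pA]] := @perm_set_fixing _ j0 (nb x') B _ j0B (esym cB).
    by rewrite nbE ej0; apply/asboolP/adj_sym.
  have [f fA [fx fe]] := star_extends p eP.
  have fy : f y = y by rewrite -ej0 fe pj0.
  suff -> : B = nb (f x') by apply: GP; rewrite -fy; apply/(aut_adj _ _ fA).
  apply/setP => j; rewrite -pA -[j](permKV p) (mem_imset _ _ perm_inj) !nbE -fe.
  by apply/asboolP/asboolP => /(aut_adj _ _ fA).
have cardG x' : adj y x' -> x <> x' -> 'C(a.-1, #|nb x'|.-1) < #|G|.
  move=> yx' xx'; set k := #|nb x'|; have /andP[k1 ka] := bounds x' yx' xx'.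
  pose D := [set B : {set 'I_a} | B \subset [set~ j0] & #|B| == k.-1].
  have DP B : B \in D -> j0 \notin B /\ #|B| = k.-1.
    by rewrite inE => /andP[/subsetP sB /eqP ->]; split=> //; apply/negP => /sB; rewrite !inE eqxx.
  have <- : #|[set j0 |: B | B in D]| = 'C(a.-1, k.-1).
    rewrite card_in_imset ?cards_draws ?cardsC1 ?card_ord // => B B' /DP[nB _] /DP[nB' _] E.
    by rewrite -(setU1K nB) -(setU1K nB') E.
  have cD B : B \in D -> #|j0 |: B| = k by move/DP=> [nB cB]; rewrite cardsU1 nB cB; lia.
  (* The full set is the trace of [x] itself and has more than [k] elements; this extra member makes
     the inequality strict. *)
  have TN : setT \notin [set j0 |: B | B in D].
    apply/negP => /imsetP[B BD E]; have := cD B BD; rewrite -E cardsT card_ord; rewrite -/k in ka; lia.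
  have <- : #|setT |: [set j0 |: B | B in D]| = #|[set j0 |: B | B in D]|.+1.
    by rewrite cardsU1 TN.
  apply/subset_leq_card/subsetP => B; rewrite in_setU1 => /orP[/eqP->|/imsetP[B' B'D ->]].
    have <- : nb x = setT by apply/setP => j; rewrite nbE !inE; apply/asboolP/eE; exists j.
    exact/GP/adj_sym.
  by apply: (all x') => //; [rewrite !inE eqxx | exact: cD].
have Gb : #|G| <= b by rewrite -[X in _ <= X]card_ord; apply: leq_imset_card.
have cb x' : adj y x' -> x <> x' -> a <= #|G|.
  move=> yx' xx'; have := cardG x' yx' xx'; have := bounds x' yx' xx'.
  by have := @leq_bin a.-1 #|nb x'|.-1; lia.
have [x0 yx0 xx0] := nonleaf (adj_sym xy).
have aG := cb x0 yx0 (nesym xx0).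
split=> [|ba]; first exact: leq_trans Gb.
split.
  (* Now [a <= #|G| <= b <= a], so distinct neighbours of [y] leave distinct traces. *)
  have /imset_injP inj : #|G| == #|'I_b| by rewrite card_ord eqn_leq Gb (leq_trans ba).
  move=> u v /e'E[i <-] /e'E[j <-] uv; congr e'; apply: inj => //.
  apply/setP => t; rewrite !nbE; have xt : adj x (e t) by apply/eE; exists t.
  by apply/asboolP/asboolP => /uv; apply.
move=> x' yx' xx'; have kb := bounds x' yx' xx'; have kc := cardG x' yx' xx'.
have [k2|k2] := eqVneq #|nb x'| 2; [right|left].
  have /eqP/cards2P[j1 [j2 [_ E]]] := k2.
  have nbc z : adj x z -> adj x' z -> z = e j1 \/ z = e j2.
    move=> /eE[j <-] x'j; have : j \in nb x' by rewrite nbE; apply/asboolP.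
    by rewrite E !inE => /orP[]/eqP->; [left|right].
  move=> z1 z2 z3 x1 x2 x3 y1 y2 y3.
  have [->|->] := nbc z1 x1 y1; have [->|->] := nbc z2 x2 y2; have [->|->] := nbc z3 x3 y3;
    by [left | right; left | right; right].
(* Since [#|G| <= a], [ltn_bin] excludes every [k] strictly between 2 and [a - 1]. *)
have ka : #|nb x'| = a.-1 by have := @ltn_bin a.-1 #|nb x'|.-1; lia.
have /card_le1_eqP c1 : #|~: nb x'| <= 1 by have := cardsC (nb x'); rewrite card_ord; lia.
move=> z1 z2 /eE[i1 <-] /eE[i2 <-] n1 n2; congr e.
by apply: c1; rewrite !inE; apply/asboolPn.
Qed.

(** If [x'] missed two neighbours [z], [z'] of [x], an automorphism fixing [x], [x'] and all
    neighbours of [x'] would take [z] to [z']. It fixes each neighbour [w] of [y], which is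
    determined by its trace on the neighbours of [x']. So a [w] adjacent to [z] shares [y], [z] and
    [z'] with [x], too many for [at_most_two_common]. *)
Lemma nonadjacent_unique_in_nbhd x x' y :
  adj x y -> adj x' y -> x <> x' -> misses_at_most_one x x'.
Proof.
move=> xy x'y xx'.
(* Used in both directions along an edge, [common_nbr_count] gives equal degrees, and its second
   half becomes available. *)
have count u v : adj u v ->
    (forall s t, adj v s -> adj v t -> (forall w, adj u w -> adj s w <-> adj t w) -> s = t) /\
    (forall u', adj v u' -> u <> u' -> misses_at_most_one u u' \/ at_most_two_common u u').
  move=> uv; have [a [e eP]] := finite_enumerates (locfin u).
  have [b [e' e'P]] := finite_enumerates (locfin v).
  have [ab] := common_nbr_count uv eP e'P; apply.
  by have [] := common_nbr_count (adj_sym uv) e'P eP.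
apply: contrapT => N; apply: (N) => z z' xz xz' x'z x'z'; apply: contrapT => zz'.
have ny t : ~ adj x' t -> y <> t by move=> nt E; apply: nt; rewrite -E.
pose S v := (v = x' \/ adj x' v) \/ v = x.
have px : part x = part x' := common_nbr_part bip x'y (adj_sym xy).
have notS t : adj x t -> ~ adj x' t -> ~ S t.
  move=> xt x't [[E|//]|E]; apply: (same_part_nadj bip _ xt); by rewrite E.
have [||||||||f fA [fS fz]] := @swap_extends _ _ _ adj_sym bip hom S x z z'.
- have [l lP] := locfin x'.
  by exists (x :: x' :: l) => v [[->|/lP]|->]; [right; left|right; right|left].
- apply: (@connected_setU1 _ _ adj_sym _ y) => //; [|by right|exact: adj_sym].
  have to_x v : v = x' \/ adj x' v -> conn_in adj (fun v => v = x' \/ adj x' v) v x'.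
    case=> [->|xv]; first exact: rt_refl.
    by apply: rt_step; split; [right | split; [left | exact: adj_sym]].
  by move=> u v /to_x ux /to_x vx; apply: rt_trans ux (conn_in_sym adj_sym vx).
- by right.
- by [].
- exact: notS.
- exact: notS.
- by rewrite (adj_part bip xz) (adj_part bip xz').
- move=> v [[->|x'v]|->]; [by split|split=> E|by split].
    by case: (same_part_nadj bip _ E); rewrite (adj_part bip x'v) (adj_part bip xz) px.
  by case: (same_part_nadj bip _ E); rewrite (adj_part bip x'v) (adj_part bip xz') px.
have [w wx [yw zw]] := second_common_nbr (adj_sym xy) (adj_sym xz) (ny z x'z).
have fw : f w = w.
  have [inj _] := count x' y x'y; apply: inj => //.
    by rewrite -[y]fS; [apply/(aut_adj _ _ fA) | left; right].
  move=> t x't; rewrite -{1}[t]fS; last by left; right.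
  exact: (aut_adj _ _ fA).
have wz' : adj w z' by rewrite -fw -fz; apply/(aut_adj _ _ fA)/adj_sym.
have [_ /(_ w yw (nesym wx))[U|T]] := count x y xy.
  (* The other alternative, for [x] and [w], is carried to [x] and [x'], against the assumption. *)
  have [|g gA [gx gy gw]] := path2_extends xy yw (nesym wx) xy (adj_sym x'y) xx'; first by [].
  apply: N => t1 t2; have [s1 <-] := aut_surj t1 gA; have [s2 <-] := aut_surj t2 gA.
  rewrite -{1 2}gx -gw !(aut_adj _ _ gA) => *; congr g; exact: U.
have [] := T y z z' xy xz xz' (adj_sym yw) (adj_sym zw) wz'; first exact: ny.
by case=> //; apply: ny.
Qed.

(** A walk [x], [z], [t], [u], [v] can be shortened: [x] and [t] share two neighbours, and [v]
    misses at most one neighbour of [t]. *)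
Lemma common_nbr x v : part v = part x -> v = x \/ exists2 z, adj x z & adj v z.
Proof.
suff : (part v = part x -> v = x \/ exists2 z, adj x z & adj v z) /\
  (part v <> part x -> exists2 t, adj v t & t = x \/ exists2 z, adj x z & adj t z) by case.
move: v; apply: (@graph_ind _ _ conn _ x) => [|u v uv [Pu Qu]].
  by split=> // _; left.
have pv := adj_part bip uv; split=> E; last first.
  exists u; first exact: adj_sym.
  by apply: Pu; move: E; rewrite pv; case: (part u); case: (part x).
have [|t ut [Et|[z xz tz]]] := Qu; first by rewrite -E pv; case: (part u).
  by right; exists u; apply: adj_sym => //; rewrite -Et.
have [xt|xt] := pselect (x = t); first by right; exists u; apply: adj_sym => //; rewrite xt.
have [tv|tv] := pselect (t = v); first by right; exists z => //; rewrite -tv.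
have [z' zz' [xz' tz']] := second_common_nbr xz tz xt.
right; have [vz|vz] := pselect (adj v z); first by exists z.
exists z' => //; apply: contrapT => vz'; apply: zz'.
have U := nonadjacent_unique_in_nbhd (adj_sym ut) (adj_sym uv) tv.
exact: U.
Qed.

(** If [x] had two non-neighbours [z], [t] in the other part, it would miss two neighbours of a
    common neighbour [v] of [z] and [t]. *)
Lemma square_case : exists n, graph_iso adj (@cpm_adj n).
Proof.
apply: (cpm_recognition adj_sym conn bip locfin) => x.
have [y xy] := has_nbr x.
have [x' yx' x'x] := nonleaf (adj_sym xy).
have [z x'z xz] := nbr_not_included (adj_sym yx') xy x'x.
have px' := common_nbr_part bip xy yx'.
have pz : part z = ~~ part x by rewrite (adj_part bip x'z) px'.
exists z; split; first by rewrite pz; case: (part x).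
move=> t pt; split=> [xt E|tz]; first by apply: xz; rewrite -E.
apply: contrapT => xt.
have ptz : part t = part z by rewrite pz; move: pt; case: (part t); case: (part x).
have [//|[v zv tv]] := common_nbr ptz.
have pv : part v = part x by rewrite (adj_part bip zv) pz negbK.
have [E|[w xw vw]] := common_nbr pv; first by apply: xt; apply: adj_sym; rewrite -E.
have vx : v <> x by move=> E; apply: xt; apply: adj_sym; rewrite -E.
by apply: tz; apply: (nonadjacent_unique_in_nbhd vw xw vx) => //; apply: adj_sym.
Qed.

End Squares.

(** * Assembling the classification *)

Lemma homogeneous_classification (V : Type) (adj : V -> V -> Prop) (part : V -> bool) :
  simple_graph adj -> connected_graph adj -> locally_finite adj -> bipartition adj part ->
  connected_homogeneous_bip adj part ->
  (exists m : nat, 3 <= m /\ ~~ odd m /\ graph_iso adj (@cycle_adj m)) \/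
  (exists a b : nat, is_semiregular_tree adj a b) \/
  (exists m n : nat, graph_iso adj (@Kmn_adj m n)) \/
  (exists n : nat, graph_iso adj (@cpm_adj n)).
Proof.
move=> [adj_sym adj_irr] conn locfin bip hom.
have [p4|not_p4] := pselect (P4_closed adj).
  by right; right; left; exact: (complete_bipartite_recognition adj_sym conn bip locfin p4).
have min2 := nonleaf adj_sym bip hom not_p4.
have nbr := has_nbr adj_sym bip hom not_p4.
case: (conn) => -[x0] _.
have [[k [c kc]]|acyc] := pselect (has_cycle adj); last first.
  right; left.
  have deg v : exists d, has_degree adj v d.
    by have [d eP] := finite_enumerates (locfin v); exists d; apply/has_degreeP.
  have [y0 xy0] := nbr x0.
  have [s [t [ps pt]]] : exists s t, part s = true /\ part t = false.
    have := adj_part bip xy0.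
    by case px: (part x0) => py; [exists x0, y0 | exists y0, x0].
  have [a da] := deg s; have [b db] := deg t; exists a, b; split=> //; split.
    exact: acyclic_infinite xy0 min2 acyc.
  exists part; split=> //; split=> v pv.
    by apply: (degree_on_parts bip hom _ da); rewrite ps pv.
  by apply: (degree_on_parts bip hom _ db); rewrite pt (negbTE pv).
have [[u deg_u]|no3] := pselect (exists u, degree_ge3 adj u).
  have [c4|square] := pselect (C4_free adj).
    by case: (square_free_acyclic adj_sym adj_irr conn bip hom c4 min2 deg_u); exists k, c.
  by right; right; right; exact: (square_case adj_sym adj_irr conn bip hom).
(* All degrees are now at most 2, so the cycle is the whole graph. *)
have [k3 [cinj cadj]] := kc.
left; exists k; split=> //; split; first exact: (cycle_even bip k3 cadj).
apply: (cycle_recognition adj_sym conn k3 cinj cadj) => v x y z vx vy vz xy.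
apply: contrapT => /not_orP[zx zy]; apply: no3; exists v, x, y, z.
by split=> //; do !split=> //; apply: nesym.
Qed.

(** * The finite graphs are homogeneous *)

Section Transport.

Variables (V W : Type) (adjV : V -> V -> Prop) (adjW : W -> W -> Prop).
Variables (f : V -> W) (g : W -> V).
Hypotheses (fK : cancel f g) (gK : cancel g f).
Hypothesis f_adj : forall x y, adjV x y <-> adjW (f x) (f y).

Lemma conn_in_iso (A : V -> Prop) x y :
  conn_in adjV A x y -> conn_in adjW (fun w => A (g w)) (f x) (f y).
Proof.
elim=> [u v [Au [Av uv]]|u|u v w _ IH1 _ IH2].
- by apply: rt_step; rewrite !fK; do !split => //; apply/f_adj.
- exact: rt_refl.
- exact: rt_trans IH1 IH2.
Qed.

Lemma connected_set_iso (A : V -> Prop) :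
  connected_set adjV A -> connected_set adjW (fun w => A (g w)).
Proof. by move=> Ac x y Ax Ay; rewrite -[x]gK -[y]gK; apply/conn_in_iso/Ac. Qed.

Lemma finite_set_iso (A : V -> Prop) : finite_set A -> finite_set (fun w => A (g w)).
Proof.
case=> l lP; exists (map f l) => w /lP wl; rewrite -[w]gK.
exact: (@List.in_map V W f).
Qed.

Lemma connected_graph_iso : connected_graph adjV -> connected_graph adjW.
Proof.
by case=> -[x] Vc; split; [exact: inhabits (f x) | exact: (connected_set_iso Vc)].
Qed.

Lemma homogeneous_iso (part : W -> bool) :
  connected_homogeneous_bip adjW part -> connected_homogeneous_bip adjV (part \o f).
Proof.
move=> hom A B h Af Bf Ac Bc [hB [hinj [hsurj [hadj hpart]]]].
have [|phi [[[psi [phiK psiK]] [padj ppart]] phiE]] := hom _ _ (fun w => f (h (g w)))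
    (finite_set_iso Af) (finite_set_iso Bf) (connected_set_iso Ac) (connected_set_iso Bc).
  split; [|split; [|split; [|split]]].
  - by move=> x Ax; rewrite fK; apply: hB.
  - by move=> x y Ax Ay /(can_inj fK)/hinj E; rewrite -[x]gK -[y]gK E.
  - by move=> y /hsurj[x [Ax E]]; exists (f x); rewrite fK E gK.
  - by move=> x y Ax Ay; rewrite -f_adj -hadj // f_adj !gK.
  - by move=> x Ax; have := hpart _ Ax; rewrite /= gK.
exists (fun v => g (phi (f v))); split; last first.
  by move=> x Ax; rewrite phiE ?fK.
split; [|split].
- by exists (fun v => g (psi (f v))); split=> x; rewrite gK ?phiK ?psiK fK.
- by move=> x y; rewrite f_adj padj f_adj !gK.
- by move=> x; rewrite /= gK ppart.
Qed.

Lemma bipartition_iso (part : W -> bool) :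
  bipartition adjW part -> bipartition adjV (part \o f).
Proof. by move=> bip x y /f_adj/bip. Qed.

Lemma locally_finite_iso (l : seq W) : (forall w, List.In w l) -> locally_finite adjV.
Proof.
move=> lP v; exists (map g l) => w _; rewrite -[w]fK.
by apply: (@List.in_map W V g); apply: lP.
Qed.

End Transport.

Lemma finType_list (T : finType) : exists l : seq T, forall w, List.In w l.
Proof. by exists (enum T) => w; apply/InP; rewrite mem_enum. Qed.

(** * Complete bipartite graphs and complements of perfect matchings *)

Definition sum_part (S T : Type) (s : S + T) : bool := if s is inl _ then true else false.

(** [h] splits into a partial injection of each part; both extend to permutations, and any pair of
    permutations is an automorphism. *)
Lemma Kmn_homogeneous m n : connected_homogeneous_bip (@Kmn_adj m n) (@sum_part 'I_m 'I_n).
Proof.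
move=> A B h _ _ _ _ [_ [hinj [_ [_ hpart]]]].
(* The default [i] is never taken on [A], since [h] preserves the parts. *)
pose h1 i := if h (inl i) is inl j then j else i.
pose h2 i := if h (inr i) is inr j then j else i.
have h1E i : A (inl i) -> h (inl i) = inl (h1 i) 
  by move=> Ai; rewrite /h1; case: (h (inl i)) (hpart _ Ai).
have h2E i : A (inr i) -> h (inr i) = inr (h2 i) 
  by move=> Ai; rewrite /h2; case: (h (inr i)) (hpart _ Ai).
have [|p1 p1E] := @extend_perm _ [pred i | `[<A (inl i)>]] h1.
  move=> i j; rewrite !inE => /asboolP Ai /asboolP Aj E.
  by have /hinj-/(_ Ai Aj)[] : h (inl i) = h (inl j) by rewrite !h1E // E.
have [|p2 p2E] := @extend_perm _ [pred i | `[<A (inr i)>]] h2.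
  move=> i j; rewrite !inE => /asboolP Ai /asboolP Aj E.
  by have /hinj-/(_ Ai Aj)[] : h (inr i) = h (inr j) by rewrite !h2E // E.
exists (fun s => match s with inl i => inl (p1 i) | inr j => inr (p2 j) end).
split; last first.
  move=> [i|i] Ai; rewrite ?h1E ?h2E //.
    by rewrite p1E // inE; apply/asboolP.
  by rewrite p2E // inE; apply/asboolP.
split; [|split].
- exists (fun s => match s with inl i => inl ((p1^-1)%g i) | inr j => inr ((p2^-1)%g j) end).
  by split=> -[i|i]; rewrite ?permK ?permKV.
- by move=> [i|i] [j|j].
- by case.
Qed.

(** Preserving the non-adjacency of [inl i] and [inr i] makes the injections of the two parts agree
    on common indices. They glue to one injection, whose extension acts on both parts at once. *)
Lemma cpm_homogeneous n : connected_homogeneous_bip (@cpm_adj n) (@sum_part 'I_n 'I_n).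
Proof.
move=> A B h _ _ _ _ [_ [hinj [_ [hadj hpart]]]].
pose h1 i := if h (inl i) is inl j then j else i.
pose h2 i := if h (inr i) is inr j then j else i.
have h1E i : A (inl i) -> h (inl i) = inl (h1 i) 
  by move=> Ai; rewrite /h1; case: (h (inl i)) (hpart _ Ai).
have h2E i : A (inr i) -> h (inr i) = inr (h2 i) 
  by move=> Ai; rewrite /h2; case: (h (inr i)) (hpart _ Ai).
have h12 i j : A (inl i) -> A (inr j) -> h1 i = h2 j <-> i = j.
  move=> Ai Aj; have := hadj _ _ Ai Aj; rewrite h1E // h2E //= => E.
  by split=> F; apply: contrapT => /E.
have inj1 i j : A (inl i) -> A (inl j) -> h1 i = h1 j -> i = j.
  by move=> Ai Aj E; have /hinj-/(_ Ai Aj)[] : h (inl i) = h (inl j) by rewrite !h1E // E.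
have inj2 i j : A (inr i) -> A (inr j) -> h2 i = h2 j -> i = j.
  by move=> Ai Aj E; have /hinj-/(_ Ai Aj)[] : h (inr i) = h (inr j) by rewrite !h2E // E.
pose h0 i := if pselect (A (inl i)) then h1 i else h2 i.
have h01 i : A (inl i) -> h0 i = h1 i by rewrite /h0; case: pselect.
have h02 i : A (inr i) -> h0 i = h2 i.
  by move=> Ai; rewrite /h0; case: pselect => // A1; apply/h12.
have [|p pE] := @extend_perm _ [pred i | `[<A (inl i) \/ A (inr i)>]] h0.
  move=> i j; rewrite !inE => /asboolP[Ai|Ai] /asboolP[Aj|Aj].
  - by rewrite !h01 //; apply: inj1.
  - by rewrite h01 // h02 // => /(h12 _ _ Ai Aj).
  - by rewrite h02 // h01 // => /esym/(h12 _ _ Aj Ai).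
  - by rewrite !h02 //; apply: inj2.
have pA i : A (inl i) \/ A (inr i) -> p i = h0 i by move=> Ai; apply: pE; rewrite inE; apply/asboolP.
exists (fun s => match s with inl i => inl (p i) | inr j => inr (p j) end).
split; last first.
  by move=> [i|i] Ai; [rewrite h1E // pA ?h01 //; left | rewrite h2E // pA ?h02 //; right].
split; [|split].
- exists (fun s => match s with inl i => inl ((p^-1)%g i) | inr j => inr ((p^-1)%g j) end).
  by split=> -[i|i]; rewrite ?permK ?permKV.
- by move=> [i|i] [j|j] //=; split=> ne E; apply: ne; [exact: perm_inj E | rewrite E
    | exact: perm_inj E | rewrite E].
- by case.
Qed.

Lemma part_preserved (V : Type) (adj : V -> V -> Prop) (part : V -> bool) (phi : V -> V) a :
  connected_graph adj -> bipartition adj part ->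
  (forall x y, adj x y -> adj (phi x) (phi y)) -> part (phi a) = part a ->
  forall x, part (phi x) = part x.
Proof.
move=> conn bip padj pa; apply: (graph_ind conn pa) => u v uv pu.
by rewrite (adj_part bip uv) (adj_part bip (padj _ _ uv)) pu.
Qed.

(** * Even cycles *)

Section Cycle.

Import GRing.Theory.
Local Open Scope ring_scope.

Variable n : nat.
Notation adj := (@cycle_adj n.+3).

(** The cycle is the Cayley graph of the integers modulo [n.+3] with generators 1 and -1. *)
Lemma cycle_adjE (i j : 'I_n.+3) : adj i j <-> j - i = 1 \/ j - i = - 1.
Proof.
have E (u v : 'I_n.+3) : val v = ((val u + 1) %% n.+3)%N <-> v = u + 1.
  by split=> [H|->]; [apply: val_inj; rewrite H|]; rewrite /= modnDmr.
rewrite /cycle_adj !E; split=> -[H|H]; [left|right|left|right].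
- by rewrite H; ring.
- by rewrite H; ring.
- by rewrite -H; ring.
- by rewrite -[1]opprK -H; ring.
Qed.

(** A rotation if both edges run in the same direction, a reflection otherwise. *)
Lemma cycle_extends (a a' b b' : 'I_n.+3) : adj a a' -> adj b b' ->
  exists phi psi : 'I_n.+3 -> 'I_n.+3, [/\ cancel phi psi, cancel psi phi,
    forall x y, adj x y <-> adj (phi x) (phi y), phi a = b & phi a' = b'].
Proof.
move=> aa' bb'.
have [E|E] : b' - b = a' - a \/ b' - b = - (a' - a).
  by move: aa' bb'; rewrite !cycle_adjE => -[->|->] [->|->]; rewrite ?opprK;
    by [left | right].
- exists (fun i => b + (i - a)), (fun i => a + (i - b)); split.
  + by move=> i; ring.
  + by move=> i; ring.
  + move=> x y; rewrite !cycle_adjE.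
    by have -> : b + (y - a) - (b + (x - a)) = y - x by ring.
  + by ring.
  + by rewrite -E; ring.
- exists (fun i => b - (i - a)), (fun i => a - (i - b)); split.
  + by move=> i; ring.
  + by move=> i; ring.
  + move=> x y; rewrite !cycle_adjE.
    have -> : b - (y - a) - (b - (x - a)) = - (y - x) by ring.
    by split=> -[H|H]; [right|left|right|left]; rewrite -[LHS]opprK ?H ?opprK // H.
  + by ring.
  + by rewrite -E; ring.
Qed.

Lemma cycle_nbr_unique (w u u' v : 'I_n.+3) :
  adj w u -> adj w u' -> adj w v -> u <> v -> u' <> v -> u = u'.
Proof.
have sol t s : t - w = s -> t = s + w by move=> <-; rewrite subrK.
by rewrite !cycle_adjE => -[/sol->|/sol->] [/sol->|/sol->] [/sol->|/sol->].
Qed.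

Lemma cycle_homogeneous :
  ~~ odd n.+3 -> connected_graph adj ->
  bipartition adj (fun i : 'I_n.+3 => odd i) /\
  connected_homogeneous_bip adj (fun i : 'I_n.+3 => odd i).
Proof.
move=> ev conn.
have bip : bipartition adj (fun i : 'I_n.+3 => odd i).
  move=> i j [->|->]; rewrite odd_mod ?(negbTE ev) // addn1 /=; first by case: (odd i).
  by case: (odd j).
split=> // A B h _ _ Ac _ [_ [hinj [_ [hadj hpart]]]].
have [[a Aa]|NA] := pselect (exists a, A a); last first.
  by exists id; split; [exact: aut_id | move=> x Ax; case: NA; exists x].
have nbr x : exists y, adj x y by exists (x + 1); apply/cycle_adjE; left; ring.
have adj_sym x y : adj x y -> adj y x by case=> H; [right|left].
have aut phi psi : cancel phi psi -> cancel psi phi ->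
    (forall x y, adj x y <-> adj (phi x) (phi y)) -> phi a = h a ->
    bip_automorphism adj (fun i : 'I_n.+3 => odd i) phi.
  move=> phiK psiK padj pa; split; first by exists psi.
  split=> // x; apply: (part_preserved (a := a) conn bip).
    by move=> u v /padj.
  by rewrite pa hpart.
(* Without an edge inside it, the connected set [A] is the single vertex [a]. *)
have [[a' [Aa' aa']]|iso] := pselect (exists a', A a' /\ adj a a'); last first.
  have [a' aa'] := nbr a; have [b' bb'] := nbr (h a).
  have [phi [psi [phiK psiK padj pa _]]] := cycle_extends aa' bb'.
  exists phi; split; first exact: (aut phi psi).
  suff : forall x, conn_in adj A a x -> x = a.
    by move=> E x Ax; rewrite (E x) //; exact: Ac.
  apply: conn_in_ind => // u v Au Av uv E; subst u.
  by case: iso; exists v.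
have bb' : adj (h a) (h a') := (hadj _ _ Aa Aa').1 aa'.
have [phi [psi [phiK psiK padj pa pa']]] := cycle_extends aa' bb'.
exists phi; split; first exact: (aut phi psi).
(* The induction carries a neighbour [y] in [A] where both maps agree; any other neighbour must go
   to the one place left. *)
suff H : forall x, conn_in adj A a x ->
    phi x = h x /\ exists y, [/\ A y, adj x y & phi y = h y].
  by move=> x Ax; apply: (H x _).1; exact: Ac.
apply: conn_in_ind => //; first by split=> //; exists a'.
move=> u v Au Av uv [pu [y [Ay uy py]]].
split; last by exists u; split=> //; exact: adj_sym.
have [->//|vy] := pselect (v = y).
apply: (@cycle_nbr_unique (h u) _ _ (h y)).
- by rewrite -pu; exact: (padj _ _).1 uv.
- exact: (hadj _ _ Au Av).1 uv.
- exact: (hadj _ _ Au Ay).1 uy.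
- by rewrite -py => /(can_inj phiK).
- by move/hinj => E; apply: vy; apply: E.
Qed.

End Cycle.

(** * Semiregular trees are homogeneous *)

Section Trees.

Variables (V : Type) (adj : V -> V -> Prop).
Hypothesis adj_sym : forall x y, adj x y -> adj y x.
Hypothesis adj_irr : forall x, ~ adj x x.
Hypothesis conn : connected_graph adj.

(** The analogue of a reduced word: a walk without backtracking. *)
Fixpoint reduced (l : seq V) : Prop :=
  match l with
  | x :: l' =>
      match l' with
      | y :: l'' => adj x y /\ (if l'' is z :: _ then x <> z else True)
      | [::] => True
      end /\ reduced l'
  | [::] => True
  end.

Lemma reduced_nth x0 l : reduced l ->
  (forall i, i.+1 < size l -> adj (nth x0 l i) (nth x0 l i.+1)) /\
  (forall i, i.+2 < size l -> nth x0 l i <> nth x0 l i.+2).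
Proof.
elim: l => [|x l IHl] //= [xl /IHl[ladj lne]]; split=> -[|i] //=.
- by case: l xl {IHl ladj lne} => // y l [].
- exact: ladj.
- by case: l xl {IHl ladj lne} => // y [|z l] [].
- exact: lne.
Qed.

Lemma reduced_catrev v l1 l2 : reduced (v :: l1) -> reduced (v :: l2) ->
  (if (l1, l2) is (x :: _, y :: _) then x <> y else True) -> reduced (catrev l1 (v :: l2)).
Proof.
elim: l1 v l2 => [|w l1 IHl] v l2 //= [[vw vl1] rwl1] rvl2 wl2.
apply: IHl => //; last by case: l1 vl1 {rwl1} => // z l1; apply: nesym.
by split=> //; split; [apply: adj_sym | case: l2 wl2 {rvl2}].
Qed.

Lemma head_catrev x0 v (l1 l2 : seq V) : head x0 (catrev l1 (v :: l2)) = last v l1.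
Proof. by elim: l1 v l2 => [|w l1 IHl] v l2 //=; rewrite IHl. Qed.

Lemma last_catrev x0 v (l1 l2 : seq V) : last x0 (catrev l1 (v :: l2)) = last v l2.
Proof. by elim: l1 v l2 => [|w l1 IHl] v l2 //=; rewrite IHl. Qed.

(** A walk in [A] is built edge by edge and shortened whenever the new edge backtracks. *)
Lemma reduced_path_exists (A : V -> Prop) r v : connected_set adj A -> A r -> A v ->
  exists l, [/\ reduced (v :: l), last v l = r & forall x, List.In x (v :: l) -> A x].
Proof.
move=> Ac Ar Av; have {Ac Av} rv := Ac _ _ Ar Av.
move: v rv; apply: conn_in_ind => //; first by exists [::]; split=> // x [<-|[]].
move=> u v Au Av uv [l [rl lastl lA]]; have vu := adj_sym uv.
case: l => [|w l] in rl lastl lA *.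
  by exists [:: u]; split=> // x [<-|] //; apply: lA.
have [E|vw] := pselect (v = w).
  subst w; exists l; split=> //; first by case: rl.
  by move=> x xl; apply: lA; right.
exists [:: u, w & l]; split=> // x [<-|] //; exact: lA.
Qed.

Hypothesis acyc : ~ has_cycle adj.

Lemma reduced_not_closed x0 l : reduced l -> 1 < size l -> head x0 l <> last x0 l.
Proof.
move=> /(reduced_nth x0)[ladj lne] l2 E; apply: acyc.
have [||||k [d [kd _]]] :=
  @closed_walk_cycle _ _ adj_irr (nth x0 l) (size l).-1 0 (size l).-1.
- by move=> i il; apply: ladj; lia.
- by move=> i il; apply: lne; lia.
- by lia.
- by rewrite nth0 nth_last.
by exists k, d.
Qed.

(** Where the walks first part, one reversed and the other join to a closed reduced walk. *)
Lemma reduced_unique v l1 l2 : reduced (v :: l1) -> reduced (v :: l2) ->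
  last v l1 = last v l2 -> l1 = l2.
Proof.
elim: l1 v l2 => [|w1 l1 IHl] v [|w2 l2] // r1 r2 E.
- by case: (@reduced_not_closed v _ r2).
- by case: (@reduced_not_closed v _ r1).
have [Ew|nw] := pselect (w1 = w2).
  by subst w2; rewrite (IHl w1 l2) //; [case: r1 | case: r2].
case: (@reduced_not_closed v _ (reduced_catrev r1 r2 nw)).
  by rewrite catrevE size_cat size_rev /=; lia.
by rewrite head_catrev last_catrev.
Qed.

(** Local injectivity keeps reduced walks reduced, so equal images of distinct vertices would give a
    closed reduced walk; surjectivity spreads along edges. *)
Lemma tree_covering_aut (part : V -> bool) (phi : V -> V) :
  (forall u v, adj u v -> adj (phi u) (phi v)) ->
  (forall u v w, adj u v -> adj u w -> phi v = phi w -> v = w) ->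
  (forall u w, adj (phi u) w -> exists2 v, adj u v & phi v = w) ->
  (forall x, part (phi x) = part x) -> bip_automorphism adj part phi.
Proof.
move=> padj pinj psurj ppart.
have rmap l : reduced l -> reduced (map phi l).
  elim: l => [|x l IHl] // [xl rl]; split; last exact: IHl.
  case: l xl rl {IHl} => [|y [|z l]] //= [xy xz] [yz _]; split=> //; try exact: padj.
  by move=> E; apply: xz; apply: (pinj y) E; [exact: adj_sym | case: yz].
have inj : injective phi.
  move=> x y E; apply: contrapT => xy; case: (conn) => _ /reduced_path_exists.
  move=> /(_ x y I I)[[|z l] [rl lastl _]]; first by apply: xy.
  have := @reduced_not_closed (phi x) _ (rmap _ rl); rewrite /= last_map => /(_ isT).
  by rewrite -[last z l]/(last y (z :: l)) lastl E.
have surj w : exists v, phi v = w.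
  case: (conn) => -[x] _; move: w; apply: (@graph_ind _ _ conn _ (phi x)); first by exists x.
  by move=> u v uv [t E]; subst u; have [s _ <-] := psurj _ _ uv; exists s.
split; last split=> //.
  by have [psi psiP] := choice surj; exists psi; split=> // x; apply: inj.
move=> x y; split=> [|/psurj[v xv /inj <- //]]; exact: padj.
Qed.

(** Both neighbourhoods are indexed by ['I_d], where the values prescribed on [C] extend to a
    permutation. *)
Lemma local_bijection u q d (C : V -> Prop) (h : V -> V) :
  has_degree adj u d -> has_degree adj q d ->
  (forall v, adj u v -> C v -> adj q (h v)) ->
  (forall v w, adj u v -> adj u w -> C v -> C w -> h v = h w -> v = w) ->
  exists beta, [/\ forall v, adj u v -> adj q (beta v),
    forall v w, adj u v -> adj u w -> beta v = beta w -> v = w,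
    forall w, adj q w -> exists2 v, adj u v & beta v = w &
    forall v, adj u v -> C v -> beta v = h v].
Proof.
move=> /has_degreeP[e [inj_e eE]] /has_degreeP[e' [inj_e' e'E]] hadj hinj.
have ue i : adj u (e i) by apply/eE; exists i.
have /choice[k kE] : forall i, exists j, C (e i) -> e' j = h (e i).
  move=> i; have [Ci|NC] := pselect (C (e i)); last by exists i.
  by have /e'E[j <-] := hadj _ (ue i) Ci; exists j.
have [|p pE] := @extend_perm _ [pred i | `[<C (e i)>]] k.
  move=> i j; rewrite !inE => /asboolP Ci /asboolP Cj /(congr1 e'); rewrite !kE // => E.
  exact/inj_e/(hinj _ _ (ue i) (ue j) Ci Cj).
have /choice[beta bE] : forall v, exists w, forall i, v = e i -> w = e' (p i).
  move=> v; have [/eE[i <-]|nv] := pselect (adj u v).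
    by exists (e' (p i)) => j /inj_e ->.
  by exists v => i E; case: nv; rewrite E.
have be i : beta (e i) = e' (p i) by apply: bE.
exists beta; split.
- by move=> v /eE[i <-]; rewrite be; apply/e'E; exists (p i).
- by move=> v w /eE[i <-] /eE[j <-]; rewrite !be => /inj_e'/perm_inj ->.
- by move=> w /e'E[i <-]; exists (e ((p^-1)%g i)) => //; rewrite be permKV.
- by move=> v /eE[i <-] Ci; rewrite be pE ?kE // inE; apply/asboolP.
Qed.

Variables (part : V -> bool) (deg : bool -> nat).
Hypothesis bip : bipartition adj part.
Hypothesis degP : forall v, has_degree adj v (deg (part v)).

(* The extension of h is a covering map of the tree: it is defined along the reduced path
   from a root r in A, by a bijection of neighbourhoods at each step, which is forced to
   agree with h inside A and with the image of the previous vertex outside A. *)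
Lemma tree_homogeneous : connected_homogeneous_bip adj part.
Proof.
move=> A B h _ _ Ac _ [_ [hinj [_ [hadj hpart]]]].
have [[r Ar]|NA] := pselect (exists r, A r); last first.
  by exists id; split; [exact: aut_id | move=> x Ax; case: NA; exists x].
(* Here [q] is the image of [u], [w] the previous vertex towards the root and [q'] its image.
   Choosing the bijections for all data in advance allows a structural recursion. *)
have bex (t : V * V * V * V) : exists beta : V -> V, let: (u, q, w, q') := t in
    part q = part u -> (A u -> q = h u) -> (~ A u -> adj u w /\ adj q q') ->
    [/\ forall v, adj u v -> adj q (beta v),
        forall v w, adj u v -> adj u w -> beta v = beta w -> v = w,
        forall w, adj q w -> exists2 v, adj u v & beta v = w &
        (A u -> forall v, adj u v -> A v -> beta v = h v) /\ (~ A u -> beta w = q')].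
  case: t => [[[u q] w] q'].
  have [pq|nq] := pselect (part q = part u); last by exists id.
  have dq : has_degree adj q (deg (part u)) by rewrite -pq.
  have [Au|NAu] := pselect (A u).
    have [qu|nqu] := pselect (q = h u); last by exists id => _ /(_ Au).
    have [||beta [b1 b2 b3 b4]] := @local_bijection u q _ A h (degP u) dq.
    - by move=> v uv Av; rewrite qu; exact: (hadj _ _ Au Av).1 uv.
    - by move=> v w' _ _ Av Aw; apply: hinj.
    by exists beta => _ _ _; split.
  have [[uw qq']|N] := pselect (adj u w /\ adj q q'); last by exists id => _ _ /(_ NAu).
  have [||beta [b1 b2 b3 b4]] :=
      @local_bijection u q _ (fun v => v = w) (fun=> q') (degP u) dq.
  - by [].
  - by move=> v w' _ _ -> ->.
  by exists beta => _ _ _; split=> //; split=> // _; apply: b4.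
have {bex}[beta betaP] := choice bex.
(* [Phi v l] is the image of [v] computed along the walk [l] to the root. The fallback values at the
   root are harmless, the root being in [A]. *)
pose Phi := fix Phi (v : V) (l : seq V) {struct l} : V :=
  match l with
  | [::] => h v
  | u :: l' => beta (u, Phi u l', head u l',
                     match l' with [::] => h u | w :: l'' => Phi w l'' end) v
  end.
pose b u l := beta (u, Phi u l, head u l, match l with [::] => h u | w :: l'' => Phi w l'' end).
have PhiE v u l : Phi v (u :: l) = b u l v by [].
(* By uniqueness the reduced walk to the root is the one that exists inside [A]. *)
have inA v l x : reduced (v :: l) -> last v l = r -> A v -> List.In x l -> A x.
  move=> rl lastl Av xl; have [l' [rl' lastl' l'A]] := reduced_path_exists Ac Ar Av.
  by apply: l'A; right; rewrite -(reduced_unique rl rl') // lastl.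
have Inv l v : reduced (v :: l) -> last v l = r ->
    [/\ part (Phi v l) = part v, A v -> Phi v l = h v &
        if l is u :: l' then adj (Phi u l') (Phi v l) else True].
  elim: l v => [|u l IHl] v rl lastl.
    by rewrite /= in lastl *; split=> //; apply: hpart; rewrite lastl.
  have rul : reduced (u :: l) by case: rl.
  have vu : adj v u by case: rl => [[]].
  have [pu Pu adju] := IHl u rul lastl.
  have [|b1 b2 b3 [b4 b5]] := betaP (u, Phi u l, head u l,
      match l with [::] => h u | w :: l'' => Phi w l'' end) pu Pu.
    case: l {IHl} lastl rul rl adju {pu Pu} => [|w l] lastl rul rl adju NAu.
      by case: NAu; rewrite -[u]/(last v [:: u]) lastl.
    by split; [case: rul => [[]] | apply: adj_sym].
  have qv : adj (Phi u l) (Phi v (u :: l)) by rewrite PhiE; apply/b1/adj_sym.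
  split=> //; first by rewrite (adj_part bip qv) (adj_part bip (adj_sym vu)) pu.
  move=> Av; rewrite PhiE; apply: b4 => //; last exact: adj_sym.
  by apply: (inA v (u :: l)) => //; left.
have /choice[P PP] : forall v, exists l, reduced (v :: l) /\ last v l = r.
  move=> v; case: (conn) => _ /reduced_path_exists/(_ I I)-/(_ r v)[l [rl lastl _]].
  by exists l.
(* The edge either retraces the root path of [v] or prolongs it; uniqueness identifies the root path
   of [u]. *)
have Padj u v : adj u v -> P v = u :: P u \/ P u = v :: P v.
  move=> uv; have [ru lu] := PP u; have [rv lv] := PP v.
  case Ev: (P v) => [|w l].
    right; rewrite Ev in rv lv; apply: reduced_unique ru _ _; last by rewrite lu.
    by split.
  have [wu|wu] := pselect (u = w).
    left; subst w; congr (_ :: _); rewrite Ev in rv lv.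
    by apply: reduced_unique ru _; [case: rv | rewrite lu].
  right; rewrite Ev in rv lv; apply: reduced_unique ru _ _; last by rewrite lu.
  by split.
pose phi v := Phi v (P v).
have bP u : [/\ forall v, adj u v -> adj (phi u) (b u (P u) v),
    forall v w, adj u v -> adj u w -> b u (P u) v = b u (P u) w -> v = w,
    forall w, adj (phi u) w -> exists2 v, adj u v & b u (P u) v = w &
    (A u -> forall v, adj u v -> A v -> b u (P u) v = h v) /\
    (~ A u -> b u (P u) (head u (P u)) = match P u with [::] => h u | w :: l => Phi w l end)].
  have [ru lu] := PP u; have [pu Pu adju] := Inv _ _ ru lu.
  apply: (betaP (u, Phi u (P u), head u (P u),
      match P u with [::] => h u | w :: l'' => Phi w l'' end) pu Pu) => NAu.
  case: (P u) ru lu adju => [|w l] ru lu adju; first by case: NAu; rewrite -[u]/(last u [::]) lu.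
  by split; [case: ru => [[]] | apply: adj_sym].
(* Away from the root this is the definition. Towards the root, the bijection sends the previous
   vertex back to its image when [u] is outside [A], and both sides are [h v] when [u] is in [A]. *)
have phib u v : adj u v -> phi v = b u (P u) v.
  move=> uv; have [E|E] := Padj u v uv; first by rewrite /phi E.
  have [_ _ _ [b4 b5]] := bP u; have [ru lu] := PP u; have [rv lv] := PP v.
  have [Au|NAu] := pselect (A u); last by rewrite E /= in b5 *; rewrite b5.
  have Av : A v by apply: (inA u (P u)) => //; rewrite E; left.
  by rewrite b4 //; have [_ H _] := Inv _ _ rv lv; apply: H.
exists phi; split; last first.
  by move=> x Ax; have [rx lx] := PP x; have [_ H _] := Inv _ _ rx lx; apply: H.
apply: tree_covering_aut.
- by move=> u v uv; rewrite (phib u v uv); have [b1 _ _ _] := bP u; apply: b1.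
- move=> u v w uv uw; rewrite (phib u v uv) (phib u w uw).
  by have [_ b2 _ _] := bP u; apply: b2.
- move=> u w /(let: And4 _ _ b3 _ := bP u in b3 w)[v uv bv].
  by exists v => //; rewrite (phib u v uv).
- by move=> x; have [rx lx] := PP x; have [] := Inv _ _ rx lx.
Qed.

End Trees.

(** * Equivalence of homogeneity and membership in the list *)

Theorem theorem4p6 (V : Type) (adj : V -> V -> Prop)
    (Hsimple : simple_graph adj) (Hconn : connected_graph adj) :
  (locally_finite adj /\
   exists part : V -> bool, bipartition adj part /\ connected_homogeneous_bip adj part)
  <->
  ((exists m : nat, 3 <= m /\ ~~ odd m /\ graph_iso adj (@cycle_adj m)) \/
   (exists a b : nat, is_semiregular_tree adj a b) \/
   (exists m n : nat, graph_iso adj (@Kmn_adj m n)) \/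
   (exists n : nat, graph_iso adj (@cpm_adj n))).
Proof.
split=> [[locfin [part [bip hom]]]|].
  exact: homogeneous_classification locfin bip hom.
(* The model graph inherits connectedness from [adj]; its bipartition and homogeneity are pulled
   back. *)
have transport (W : finType) (adjW : W -> W -> Prop) (partW : W -> bool) :
    graph_iso adj adjW ->
    (connected_graph adjW ->
     bipartition adjW partW /\ connected_homogeneous_bip adjW partW) ->
    locally_finite adj /\
    exists part : V -> bool, bipartition adj part /\ connected_homogeneous_bip adj part.
  move=> [f [g [fK [gK f_adj]]]].
  case/(_ (connected_graph_iso fK gK f_adj Hconn)) => bip hom.
  have [l lP] := finType_list W; split; first exact: (locally_finite_iso adj fK lP).
  exists (partW \o f); split; first exact: (bipartition_iso f_adj bip).
  exact: (homogeneous_iso fK gK f_adj hom).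
case=> [[m [m3 [ev iso]]]|[[a [b tree]]|[[m [n iso]]|[n iso]]]].
- case: m m3 ev iso => [|[|[|n]]] // _ ev iso.
  exact: (transport _ _ _ iso (cycle_homogeneous ev)).
- case: tree => [[_ acyc] [_ [part [bip [dega degb]]]]]; case: (Hsimple) => adj_sym adj_irr.
  have deg v : has_degree adj v (if part v then a else b).
    by case: ifP => [/dega|/negbT/degb].
  split; first by move=> v; have /has_degreeP[e /enumerates_finite] := deg v.
  exists part; split=> //.
  exact: (tree_homogeneous adj_sym adj_irr Hconn acyc (deg := fun p => if p then a else b)).
- apply: (transport _ _ (@sum_part _ _) iso) => _; split; last exact: Kmn_homogeneous.
  by move=> [i|i] [j|j].
- apply: (transport _ _ (@sum_part _ _) iso) => _; split; last exact: cpm_homogeneous.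
  by move=> [i|i] [j|j].
Qed.
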